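(* Let $p$ be a prime and let $R$ be a non-commutative ring of order $p^2$. Then: (a) $\Gamma_R$ is integral but not toroidal. (b) $\Gamma_R$ is planar if and only if $p = 2$, $3$ or $5$.
   Context: Rings are associative and not assumed to have a multiplicative identity. $Z(R)$ denotes the center of a ring $R$. The commuting graph $\Gamma_R$ of a non-commutative ring $R$ is the simple undirected graph with vertex set $R \setminus Z(R)$ in which two distinct vertices $x,y$ are adjacent if and only if $xy = yx$. A graph is integral if all eigenvalues of its adjacency matrix are integers. The genus $\gamma(\mathcal{G})$ is the smallest non-negative integer $g$ such that $\mathcal{G}$ embeds in the surface obtained by attaching $g$ handles to a sphere; $\mathcal{G}$ is planar if $\gamma(\mathcal{G}) = 0$ and toroidal if $\gamma(\mathcal{G}) = 1$. *)

(* Defs.v *)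
From HB Require Import structures.
From mathcomp Require Import all_boot all_order all_algebra algC.
From mathcomp Require Import all_classical all_reals all_analysis.

Set Implicit Arguments.
Unset Strict Implicit.
Unset Printing Implicit Defensive.

Import Order.TTheory GRing.Theory Num.Theory.
Import numFieldNormedType.Exports.

Local Open Scope classical_set_scope.
Local Open Scope ring_scope.

(* MathComp rings are unital, so a (possibly non-unital) associative ring is
   given by an abelian group together with a multiplication. *)
Record ring_mul (R : zmodType) (mul : R -> R -> R) : Prop := RingMul {
  ring_mulA : associative mul;
  ring_mulDl : left_distributive mul +%R;
  ring_mulDr : right_distributive mul +%R
}.

Definition ring_center (R : finZmodType) (mul : R -> R -> R) : {set R} :=
  [set z : R | [forall x, mul z x == mul x z]]%SET.

Record sgraph := SGraph {
  vertex :> finType;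
  adj : rel vertex;
  adj_sym : symmetric adj;
  adj_irr : irreflexive adj
}.

Section CommutingGraph.
Variables (R : finZmodType) (mul : R -> R -> R).

Definition commuting_rel : rel {x : R | x \notin ring_center mul} :=
  fun x y => (x != y) && (mul (val x) (val y) == mul (val y) (val x)).

Lemma commuting_rel_sym : symmetric commuting_rel.
Proof. by move=> x y; rewrite /commuting_rel eq_sym [mul _ _ == _]eq_sym. Qed.

Lemma commuting_rel_irr : irreflexive commuting_rel.
Proof. by move=> x; rewrite /commuting_rel eqxx. Qed.

Definition commuting_graph : sgraph :=
  SGraph commuting_rel_sym commuting_rel_irr.
End CommutingGraph.

Definition adjacency_matrix (F : fieldType) (G : sgraph) : 'M[F]_#|G| :=
  \matrix_(i, j) (adj (enum_val i) (enum_val j))%:R.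

(* Eigenvalues are taken among all complex algebraic numbers: a matrix with
   integer entries has no other complex eigenvalues. *)
Definition integral_graph (G : sgraph) : Prop :=
  forall a : algC, eigenvalue (adjacency_matrix algC G) a -> a \is a Num.int.

Section Genus.
Variable K : realType.

(* The sphere with g handles, as a smooth surface in K^3: two copies of a disc
   with g disjoint round holes (the regions z >= 0 and z <= 0), glued along
   their boundary circles.  The disc has centre (2g, 0) and radius 2g + 1, and
   the holes have centres (4i + 2, 0), i < g, and radius 1; they are disjoint
   and interior to the disc, so the product below is nonnegative exactly on the
   disc minus the open holes, and has simple zeros on the boundary.  For g = 0
   this is the unit sphere, for g = 1 a torus (a surface of revolution). *)
Definition surface (g : nat) : set (K * K * K) :=
  [set q | q.2 ^+ 2 =
     ((2 * g + 1)%:R ^+ 2 - (q.1.1 - (2 * g)%:R) ^+ 2 - q.1.2 ^+ 2) *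
     \prod_(i < g) ((q.1.1 - (4 * i + 2)%:R) ^+ 2 + q.1.2 ^+ 2 - 1)].

(* An embedding of G in the subspace S of X: vertices go to distinct points v x
   and the edge xy to an arc c x y, parametrized by [0, 1] from v x to v y
   (c y x is the same arc backwards).  The interiors of the arcs avoid the
   vertices, and two interior points of arcs coincide only when they are the
   same point of the same edge; in particular each arc is simple. *)
Record embedding (G : sgraph) (X : topologicalType) (S : set X)
    (v : G -> X) (c : G -> G -> K -> X) : Prop := Embedding {
  emb_vertex : forall x, S (v x);
  emb_vertex_inj : injective v;
  emb_arc : forall x y t, adj x y -> 0 <= t <= 1 -> S (c x y t);
  emb_arc_cont : forall x y, adj x y -> {within `[0, 1], continuous (c x y)};
  emb_arc0 : forall x y, adj x y -> c x y 0 = v x;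
  emb_arc1 : forall x y, adj x y -> c x y 1 = v y;
  emb_arc_rev : forall x y t, adj x y -> 0 <= t <= 1 ->
    c y x t = c x y (1 - t);
  emb_arc_vertex : forall x y z t, adj x y -> 0 < t < 1 -> c x y t <> v z;
  emb_arc_arc : forall x y x' y' s t, adj x y -> adj x' y' ->
    0 < s < 1 -> 0 < t < 1 -> c x y s = c x' y' t ->
    [/\ x' = x, y' = y & t = s] \/ [/\ x' = y, y' = x & t = 1 - s]
}.

Definition embeds_in_surface (G : sgraph) (g : nat) : Prop :=
  exists v c, @embedding G (K * K * K)%type (surface g) v c.

Definition has_genus (G : sgraph) (g : nat) : Prop :=
  embeds_in_surface G g /\
  forall h : nat, embeds_in_surface G h -> (g <= h)%N.

Definition planar (G : sgraph) : Prop := has_genus G 0.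
Definition toroidal (G : sgraph) : Prop := has_genus G 1.
End Genus.

(* Main.v *)
Require Import Defs.
From mathcomp Require Import all_boot all_order all_algebra.
From mathcomp Require Import all_classical all_reals all_analysis.
From mathcomp Require Import all_fingroup algC ring lra zify.


(** An additive subgroup of [R] has order 1, [p] or [p ^ 2]. The centralizer of a
    noncentral element is proper and nontrivial, so it has order [p], and the
    centre, a proper subgroup of it, is trivial. Two noncentral elements commute
    exactly when their centralizers coincide, so the commuting graph consists of
    [p + 1] disjoint cliques on [p - 1] vertices ([commuting_graph_cliques]). Its
    eigenvalues are among -1 and [p - 2], because summing an eigenvector over a clique
    multiplies its values by the eigenvalue plus one ([clique_union_integral]).

    For [p] = 2, 3 or 5 there are at most six cliques on at most four vertices,
    and a straight-line drawing lifts to the sphere ([clique_union_in_sphere]).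
    It then remains to show that for [p >= 7] the graph embeds neither in the
    sphere nor in the torus. As the arcs of an embedding are merely continuous,
    the proofs rest on the variation of the argument of a nonvanishing plane
    vector along a path, and on a single fact about it ([arg_var_square]): the
    variation around the boundary of a square is zero when the vector is defined
    and nonzero on the whole square.

    In the plane, two disjoint arcs parametrized by [s] and [t] give such a square
    of difference vectors. For the complete graph on five vertices, the relations
    coming from the fifteen pairs of independent edges are inconsistent modulo 2
    ([K5_not_in_plane]); this is the van Kampen obstruction. Stereographic
    projection from a further vertex settles the sphere ([K5_not_in_sphere]).

    On the torus, arcs are lifted to the universal cover, and a triangle acquires
    a class in the integral lattice of the plane. If two triangles are disjoint,
    their classes have determinant zero ([triangle_classes_parallel]): the vector
    on the square is now [theta] of the difference of the lifts, where [theta]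
    vanishes only on the lattice and is multiplied by an explicit unit complex
    number under translation by the lattice. So if two disjoint complete graphs
    on five vertices are embedded, then for at least one of them all classes are
    multiples of one primitive vector. That graph lifts to a cylinder, which is
    a punctured plane, and this contradicts the planar case
    ([two_K5_not_in_torus]). *)


Module CliquesOnSurfaces.

Set Implicit Arguments.
Unset Strict Implicit.
Unset Printing Implicit Defensive.

Import Order.TTheory GRing.Theory Num.Theory.
Import numFieldNormedType.Exports.

Local Open Scope classical_set_scope.
Local Open Scope ring_scope.

(** * Continuity *)

Section Continuity.
Variables (K : realType) (T : topologicalType).
Implicit Types (f g : T -> K) (h : T -> K * K).

Lemma cont_add f g : continuous f -> continuous g ->
  continuous (fun x => f x + g x).
Proof. by move=> cf cg x; apply: cvgD; [exact: cf | exact: cg]. Qed.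

Lemma cont_opp f : continuous f -> continuous (fun x => - f x).
Proof. by move=> cf x; apply: cvgN; exact: cf. Qed.

Lemma cont_sub f g : continuous f -> continuous g ->
  continuous (fun x => f x - g x).
Proof. by move=> cf cg; apply: cont_add => //; exact: cont_opp. Qed.

Lemma cont_mul f g : continuous f -> continuous g ->
  continuous (fun x => f x * g x).
Proof. by move=> cf cg x; apply: cvgM; [exact: cf | exact: cg]. Qed.

Lemma cont_sqr f : continuous f -> continuous (fun x => f x ^+ 2).
Proof. by move=> cf; under eq_fun do rewrite expr2; exact: cont_mul. Qed.

Lemma cont_inv f : continuous f -> (forall x, f x != 0) ->
  continuous (fun x => (f x)^-1).
Proof. by move=> cf f0 x; apply: cvgV; [exact: f0 | exact: cf]. Qed.

Lemma cont_cst (U : topologicalType) (a : U) : continuous (fun _ : T => a).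
Proof. by move=> x; exact: cvg_cst. Qed.

Lemma cont_pair (U V : topologicalType) (f : T -> U) (g : T -> V) :
  continuous f -> continuous g -> continuous (fun x => (f x, g x)).
Proof. by move=> cf cg x; apply: cvg_pair; [exact: cf | exact: cg]. Qed.

Lemma cont_comp (U V : topologicalType) (f : T -> U) (g : U -> V) :
  continuous f -> continuous g -> continuous (fun x => g (f x)).
Proof. by move=> cf cg x; apply: continuous_comp; [exact: cf | exact: cg]. Qed.

Lemma cont_fst (U V : topologicalType) (f : T -> U * V) :
  continuous f -> continuous (fun x => (f x).1).
Proof. by move=> cf; apply: (cont_comp cf) => x; exact: cvg_fst. Qed.

Lemma cont_snd (U V : topologicalType) (f : T -> U * V) :
  continuous f -> continuous (fun x => (f x).2).
Proof. by move=> cf; apply: (cont_comp cf) => x; exact: cvg_snd. Qed.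

Lemma cont_cos f : continuous f -> continuous (fun x => cos (f x)).
Proof. by move=> cf; apply: (cont_comp cf); exact: continuous_cos. Qed.

Lemma cont_sin f : continuous f -> continuous (fun x => sin (f x)).
Proof. by move=> cf; apply: (cont_comp cf); exact: continuous_sin. Qed.

Lemma cont_norm f : continuous f -> continuous (fun x => `|f x|).
Proof. by move=> cf; apply: (cont_comp cf); exact: norm_continuous. Qed.

Lemma cont_sum (I : Type) (s : seq I) (F : I -> T -> K) :
  (forall i, continuous (F i)) -> continuous (fun x => \sum_(i <- s) F i x).
Proof.
move=> cF; elim: s => [|i s IHs].
  by under eq_fun do rewrite big_nil; exact: cont_cst.
by under eq_fun do rewrite big_cons; apply: cont_add.
Qed.

End Continuity.

Lemma cont_id (T : topologicalType) : continuous (fun x : T => x).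
Proof. by move=> x; exact: cvg_id. Qed.

(* The goal is decomposed by its head symbol only: trying the lemmas in turn
   would make unification unfold the operations. *)
Ltac cont_step :=
  lazymatch goal with
  | |- forall x, @continuous_at _ _ x ?h =>
    lazymatch h with
    | fun x => x => exact: cont_id
    | fun _ => ?a => exact: cont_cst
    | fun x => (@?f x, @?g x) => apply: (@cont_pair _ _ _ f g)
    | fun x => @?f x - @?g x => apply: (@cont_sub _ _ f g)
    | fun x => @?f x + @?g x => apply: (@cont_add _ _ f g)
    | fun x => - @?f x => apply: (@cont_opp _ _ f)
    | fun x => @?f x * @?g x => apply: (@cont_mul _ _ f g)
    | fun x => @?f x ^+ 2 => apply: (@cont_sqr _ _ f)
    | fun x => cos (@?f x) => apply: (@cont_cos _ _ f)
    | fun x => sin (@?f x) => apply: (@cont_sin _ _ f)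
    | fun x => `|@?f x| => apply: (@cont_norm _ _ f)
    | fun x => fst (@?f x) => apply: (@cont_fst _ _ _ f)
    | fun x => snd (@?f x) => apply: (@cont_snd _ _ _ f)
    | pair ?a => exact: (cont_pair (@cont_cst _ _ a) (@cont_id _))
    | fst => exact: (cont_fst (@cont_id _))
    | snd => exact: (cont_snd (@cont_id _))
    | fun x => ?f (@?g x) =>
      first [assumption | apply: (@cont_comp _ _ _ g f); last assumption]
    | _ => assumption
    end
  end.
Ltac cont := repeat (cbn beta; cont_step).

(** * Arguments of plane vectors *)

Section Argument.
Variable K : realType.
Implicit Types (x y a b : K) (z w : K * K).

(** The pair [z] is a positive multiple of [(cos a, sin a)]; stating this by a
    dot and a cross product avoids square roots. *)
Definition is_arg a z : Prop :=
  0 < z.1 * cos a + z.2 * sin a /\ z.2 * cos a = z.1 * sin a.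

Lemma is_argE a z : is_arg a z ->
  exists2 r : K, 0 < r & z = (r * cos a, r * sin a).
Proof.
case: z => x y [/= r0 e]; exists (x * cos a + y * sin a) => //.
have s := cos2Dsin2 a.
have sE : sin a ^+ 2 = 1 - cos a ^+ 2 by rewrite -s; ring.
by congr (_, _); ring: sE e.
Qed.

Lemma is_arg_polar a (r : K) : 0 < r -> is_arg a (r * cos a, r * sin a).
Proof.
move=> r0; split=> /=; last by ring.
suff -> : r * cos a * cos a + r * sin a * sin a = r by [].
by rewrite -[RHS]mulr1 -(cos2Dsin2 a); ring.
Qed.

Lemma is_arg_rot a b (r : K) : 0 < r ->
  is_arg (a + b) (r * (cos a * cos b - sin a * sin b),
                  r * (cos a * sin b + sin a * cos b)).
Proof.
move=> r0; have := is_arg_polar (a + b) r0.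
by rewrite cosD sinD [sin a * cos b + _]addrC.
Qed.

(** An argument of a vector determines one of any vector within a right angle
    of it, the difference being an arctangent: this is what makes arguments
    follow a continuous motion. *)
Definition turn z w : K :=
  atan ((z.1 * w.2 - z.2 * w.1) / (z.1 * w.1 + z.2 * w.2)).

Lemma is_arg_turn a z w : is_arg a z -> 0 < z.1 * w.1 + z.2 * w.2 ->
  is_arg (a + turn z w) w.
Proof.
move=> /is_argE [r r0 ->]; rewrite /turn /=; case: w => u v /= d0.
set d := (X in 0 < X) in d0 *; set k := r * cos a * v - _.
have [lo tE] := atan_def (k / d); move: (atan _) lo tE => b lo.
have c0 : 0 < cos b by apply: cos_gt0_pihalf.
rewrite /tan => tE; have {tE} sE : sin b = k / d * cos b.
  by rewrite -tE divfK // gt_eqF.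
have s := cos2Dsin2 a; have rn : r != 0 by rewrite gt_eqF.
have dn : d != 0 by rewrite gt_eqF.
have sqE : sin a ^+ 2 = 1 - cos a ^+ 2 by rewrite -s; ring.
have uE : u = (d * cos a - k * sin a) / r.
  by rewrite /d /k; field: sqE.
have vE : v = (d * sin a + k * cos a) / r.
  by rewrite /d /k; field: sqE.
have {vE uE} -> : (u, v) = (d / (r * cos b) * (cos a * cos b - sin a * sin b),
  d / (r * cos b) * (cos a * sin b + sin a * cos b)).
  rewrite vE uE sE; have := gt_eqF c0.
  by move=> /negbT cn; congr pair; field; rewrite rn dn cn.
by apply: is_arg_rot; rewrite divr_gt0 // mulr_gt0.
Qed.

Lemma is_arg_exists z : z != 0 -> exists a, is_arg a z.
Proof.
case: z => x y z0.
have [x0|x0|x0] := ltrgtP x 0.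
- exists (pi + turn (-1, 0) (x, y)); apply: is_arg_turn => /=.
    by split; rewrite /= cospi sinpi ?mulrNN ?(mulr1, mul0r, mulr0); lra.
  by rewrite mulN1r mul0r; lra.
- exists (0 + turn (1, 0) (x, y)); apply: is_arg_turn => /=.
    by split; rewrite /= cos0 sin0 ?(mulr1, mul0r, mulr0) ?addr0.
  by rewrite mul1r mul0r addr0.
have [y0|y0|y0] := ltrgtP y 0.
- exists (- (pi / 2) + turn (0, -1) (x, y)); apply: is_arg_turn => /=.
    split; rewrite /= cosN sinN cos_pihalf sin_pihalf ?mulrNN;
    by rewrite ?(mulr1, mul0r, mulr0); lra.
  by rewrite mulN1r mul0r; lra.
- exists ((pi / 2) + turn (0, 1) (x, y)).
  apply: is_arg_turn => /=.
    by split; rewrite /= cos_pihalf sin_pihalf ?(mulr1, mul0r, mulr0) ?add0r.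
  by rewrite mul1r mul0r add0r.
by rewrite x0 y0 eqxx in z0.
Qed.

Lemma is_arg_opp a z : is_arg a z -> is_arg (a + pi) (- z).
Proof.
by case: z => x y [/= h e]; split; rewrite /= cosDpi sinDpi ?mulrNN // e.
Qed.

Lemma cossinD2piz a (n : int) :
  (cos (a + n%:~R * (2 * pi)) = cos a) * (sin (a + n%:~R * (2 * pi)) = sin a).
Proof.
have P (m : nat) b :
    (cos (b + m%:R * (2 * pi)) = cos b) * (sin (b + m%:R * (2 * pi)) = sin b).
  rewrite mulr_natl [2 * pi]mulr_natl.
  by split; rewrite ?(periodicn (@cosD2pi K)) ?(periodicn (@sinD2pi K)).
case: n => m; first by rewrite -pmulrn; split; rewrite P.
rewrite NegzE mulrNz -pmulrn mulNr.
move: (P m.+1 (a - m.+1%:R * (2 * pi))); rewrite subrK.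
by case=> c s; split; rewrite ?c ?s.
Qed.

Lemma is_argD2piz a (n : int) z : is_arg a z -> is_arg (a + n%:~R * (2 * pi)) z.
Proof. by rewrite /is_arg !cossinD2piz. Qed.

Lemma sin0_cos_gt0 a : sin a = 0 -> 0 < cos a ->
  exists n : int, a = n%:~R * (2 * pi).
Proof.
move=> s0 c0; have p0 := pi_gt0 K; have p2 : 0 < 2 * pi :> K by lra.
pose n := Num.floor (a / (2 * pi)); exists n.
pose b := a - n%:~R * (2 * pi).
have bE : a = b + n%:~R * (2 * pi) by rewrite /b subrK.
have /andP[] : n%:~R <= a / (2 * pi) < (n + 1)%:~R by rewrite floor_itv.
rewrite ler_pdivlMr // ltr_pdivrMr // intrD mulr1z => lo hi.
move: s0 c0; rewrite bE !cossinD2piz => s0 c0; rewrite -[RHS]add0r.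
congr (_ + _); have b0 : 0 <= b by rewrite /b; lra.
have b2 : b < 2 * pi by rewrite /b; lra.
apply/eqP; rewrite eq_le b0 andbT leNgt; apply/negP => bp.
have [blt|bgt|bE'] := ltrgtP b pi.
- by have := @sin_gt0_pi _ b; rewrite bp blt s0 ltxx => /(_ isT).
- have := @sin_gt0_pi _ (b - pi); rewrite subr_gt0 bgt ltrBlDl.
  have -> : b < pi + pi by lra.
  have := sinDpi (b - pi); rewrite subrK s0 => /esym/eqP.
  by rewrite oppr_eq0 => /eqP ->; rewrite ltxx => /(_ isT).
- by move: c0; rewrite bE' cospi; lra.
Qed.

Lemma is_arg_unique a b z : is_arg a z -> is_arg b z ->
  exists n : int, b = a + n%:~R * (2 * pi).
Proof.
move=> /is_argE [r r0 ->] [/= h e].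
have [||n nE] := @sin0_cos_gt0 (b - a); last by exists n; rewrite -nE addrC subrK.
- have rn : r != 0 by rewrite gt_eqF.
  apply: (mulfI rn); rewrite sinB mulr0; lra.
- rewrite -(pmulr_rgt0 _ r0) cosB; lra.
Qed.

(** Otherwise the intermediate value theorem would give a value halfway between
    two consecutive multiples of [c]. *)
Lemma cont_lattice_const (f : K -> K) (c : K) : 0 < c -> continuous f ->
  (forall t, 0 <= t <= 1 -> exists n : int, f t = n%:~R * c) -> f 0 = f 1.
Proof.
move=> c0 cf fZ.
have [n nE] := fZ 0 (ltac:(lra)); have [m mE] := fZ 1 (ltac:(lra)).
suff nm : n = m by rewrite nE mE nm.
wlog : f n m cf fZ nE mE / (n <= m)%R.
  move=> W; case: (lerP n m) => nm; first exact: (W f).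
  apply: oppr_inj; apply: (W (fun t => - f t)); rewrite ?lerN2 ?(ltW nm) //.
  - by cont.
  - by move=> t /fZ [k ->]; exists (- k); rewrite mulrNz mulNr.
  - by rewrite nE mulrNz mulNr.
  - by rewrite mE mulrNz mulNr.
rewrite le_eqVlt => /orP[/eqP //|nm]; exfalso.
have nm1 : (n%:~R + 1 <= m%:~R :> K) by rewrite -[1]/(1%:~R) -intrD ler_int; lia.
have cf' : {within `[0, 1], continuous f} by apply: continuous_subspaceT.
have vI : Num.min (f 0) (f 1) <= (n%:~R + 2^-1) * c <= Num.max (f 0) (f 1).
  rewrite nE mE min_l ?max_r ?ler_pM2r //; [|lra|lra].
  by apply/andP; split; lra.
have [t tI ft] := IVT ler01 cf' vI.
have [k] := fZ t tI; rewrite ft => /(mulIf (lt0r_neq0 c0)) kE.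
have l1 : (n < k)%R by rewrite -(ltr_int K); lra.
have l2 : (k < n + 1)%R by rewrite -(ltr_int K) intrD; lra.
by lia.
Qed.

End Argument.

(** * Continuous choice of the argument *)

Section Lifting.
Variable K : realType.
Implicit Types (f : K -> K * K) (t : K).

(** The retraction of the line onto [0, 1]; composed with it, a path on [0, 1]
    becomes a continuous function on the whole line. *)
Definition clamp t : K := (`|t| - `|t - 1| + 1) / 2.

Lemma clamp_cont : continuous clamp.
Proof. by rewrite /clamp; cont. Qed.

Lemma clamp_itv t : 0 <= clamp t <= 1.
Proof.
rewrite /clamp; have [t0|t0] := ler0P t; have [t1|t1] := ler0P (t - 1); lra.
Qed.

Lemma clamp_id t : 0 <= t <= 1 -> clamp t = t.
Proof.
move=> /andP[t0 t1]; rewrite /clamp ger0_norm // ler0_norm ?subr_le0 //.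
by field.
Qed.

Lemma clampK t : clamp (clamp t) = clamp t.
Proof. by rewrite clamp_id // clamp_itv. Qed.

Lemma clamp0 : clamp 0 = 0. Proof. by rewrite clamp_id // lexx ler01. Qed.
Lemma clamp1 : clamp 1 = 1. Proof. by rewrite clamp_id // lexx ler01. Qed.

Lemma dot_gt0 (z : K * K) : z != 0 -> 0 < z.1 * z.1 + z.2 * z.2.
Proof.
case: z => x y z0 /=; rewrite lt_neqAle -!expr2 addr_ge0 ?sqr_ge0 // andbT.
rewrite eq_sym paddr_eq0 ?sqr_ge0 // !sqrf_eq0.
by apply: contra z0 => /andP[/eqP -> /eqP ->].
Qed.

(** The inner product of [f x] and [f y] is positive on the diagonal of the
    compact unit square, hence on a uniform neighbourhood of it. *)
Lemma dot_gt0_unif (f : K * K -> K * K) :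
  continuous f -> (forall x, f x != 0) ->
  exists N : nat, forall x y : K * K, 0 <= x.1 <= 1 -> 0 <= x.2 <= 1 ->
    `|x.1 - y.1| < N.+1%:R^-1 -> `|x.2 - y.2| < N.+1%:R^-1 ->
    0 < (f x).1 * (f y).1 + (f x).2 * (f y).2.
Proof.
move=> cf f0.
have cQ : compact (`[0, 1]%classic `*` `[0, 1]%classic : set (K * K)).
  by apply: compact_setX; exact: segment_compact.
pose P (N : nat) (x : K * K) := forall y, ball x (N.+1%:R^-1 : K) y ->
  0 < (f x).1 * (f y).1 + (f x).2 * (f y).2.
have /compact_near_coveringP/(_ nat \oo P _) cov := cQ.
have [|N _ /(_ N (leqnn N)) NP] := cov.
  move=> x0 _.
  pose D (u : (K * K) * (K * K)) :=
    (f u.1).1 * (f u.2).1 + (f u.1).2 * (f u.2).2.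
  have cD : continuous D.
    have c1 : continuous (fun u : (K * K) * (K * K) => f u.1).
      by apply: (cont_comp (cont_fst (@cont_id _)) cf).
    have c2 : continuous (fun u : (K * K) * (K * K) => f u.2).
      by apply: (cont_comp (cont_snd (@cont_id _)) cf).
    by rewrite /D; cont.
  have D0 : 0 < D (x0, x0) by apply: dot_gt0.
  have : nbhs (x0, x0) (D @^-1` [set u : K | 0 < u]).
    by apply: cD; apply: open_nbhs_nbhs; split => //; exact: open_gt.
  case=> -[A B] [/= nA nB] AB.
  have : nbhs x0 (A `&` B) by apply: filterI.
  move=> /nbhs_ballP [e /= e0 be].
  have e2 : 0 < e / 2 by rewrite divr_gt0.
  near=> x N => y xy.
  have bx : ball x0 (e / 2) x by near: x; exact: nbhsx_ballx.
  have Ne : (N.+1%:R^-1 : K) < e / 2.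
    by near: N; exact: (near_infty_natSinv_lt (PosNum e2)).
  have bxy : ball x (e / 2) y by apply: (le_ball (ltW Ne)).
  apply: (AB (x, y)); split.
    by case: (be x) => //; apply: (le_ball _ bx); lra.
  by case: (be y) => //; rewrite [e]splitr; apply: ball_triangle bx bxy.
exists N => x y x1 x2 d1 d2; apply: NP; first by [].
by split.
Unshelve. all: by end_near.
Qed.

(** The argument is followed along the ray from the corner [(0, 0)], in steps
    short enough for [turn] to apply. *)
Lemma arg_lift2 (f : K * K -> K * K) :
  continuous f -> (forall x, f x != 0) ->
  exists2 T : K * K -> K, continuous T &
    forall s t, 0 <= s <= 1 -> 0 <= t <= 1 -> is_arg (T (s, t)) (f (s, t)).
Proof.
move=> cf f0; have [N dotN] := dot_gt0_unif cf f0.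
have [a argf0] := is_arg_exists (f0 (0, 0)).
pose M : K := N.+2%:R^-1.
have M0 : 0 < M by rewrite invr_gt0 ltr0n.
have MN : M < N.+1%:R^-1 by rewrite ltf_pV2 ?posrE ?ltr0n // ltr_nat.
pose g k (x : K * K) := f (k%:R * M * clamp x.1, k%:R * M * clamp x.2).
have dotg k x : (k <= N.+2)%N ->
    0 < (g k x).1 * (g k.+1 x).1 + (g k x).2 * (g k.+1 x).2.
  move=> kN; have step (c : K) : `|k%:R * M * clamp c - k.+1%:R * M * clamp c|
      < N.+1%:R^-1.
    have /andP[c0 c1] := clamp_itv c.
    have -> : k%:R * M * clamp c - k.+1%:R * M * clamp c = - (M * clamp c).
      by rewrite -natr1; ring.
    have Mc0 : 0 <= M * clamp c by apply: mulr_ge0 => //; exact: ltW.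
    rewrite normrN (ger0_norm Mc0).
    by apply: le_lt_trans MN; rewrite ler_piMr // (ltW M0).
  have itv (c : K) : 0 <= k%:R * M * clamp c <= 1.
    have /andP[c0 c1] := clamp_itv c.
    have kM0 : 0 <= k%:R * M by rewrite mulr_ge0 ?(ltW M0).
    have kM1 : k%:R * M <= 1 by rewrite ler_pdivrMr ?ltr0n // mul1r ler_nat.
    by rewrite mulr_ge0 //= mulr_ile1.
  by apply: dotN => /=.
pose h k x := turn (g k x) (g k.+1 x).
have cg k : continuous (g k).
  have cc (p : K * K -> K) : continuous p ->
      continuous (fun x => k%:R * M * clamp (p x)).
    by move=> cp; apply: cont_mul; cont; apply: (cont_comp cp clamp_cont).
  apply: (cont_comp _ cf); apply: cont_pair; apply: cc; cont.
have ch k : (k <= N.+2)%N -> continuous (h k).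
  move=> kN; rewrite /h /turn; apply: (cont_comp _ (@continuous_atan K)).
  have c1 := cg k; have c2 := cg k.+1.
  apply: cont_mul; first by cont.
  by apply: cont_inv; [cont | move=> x; rewrite gt_eqF ?dotg].
exists (fun x => a + \sum_(k < N.+2) h k x).
  apply: cont_add; first by cont.
  by apply: cont_sum => k; apply: ch; rewrite ltnW.
move=> s t sI tI.
have : forall m, (m <= N.+2)%N ->
    is_arg (a + \sum_(k < m) h k (s, t)) (g m (s, t)).
  elim=> [_|m IHm mN].
    by rewrite big_ord0 addr0 /g !mul0r.
  rewrite big_ord_recr addrA /=; apply: is_arg_turn.
    by apply: IHm; rewrite ltnW.
  by apply: dotg; rewrite ltnW.
move=> /(_ _ (leqnn _)); rewrite /g /M /= divff ?pnatr_eq0 //.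
by rewrite !mul1r !clamp_id.
Qed.

Lemma arg_lift f : continuous f -> (forall t, f t != 0) ->
  exists2 T : K -> K, continuous T &
    forall t, 0 <= t <= 1 -> is_arg (T t) (f t).
Proof.
move=> cf f0.
have [||T cT argT] := @arg_lift2 (fun x => f x.1).
- by apply: (cont_comp (cont_fst (@cont_id _)) cf).
- by [].
exists (fun t => T (t, 0)).
  by apply: (cont_comp _ cT); cont.
by move=> t tI; apply: (argT t 0) => //; lra.
Qed.

(** The net change of a continuous argument along a path in the punctured plane;
    it does not depend on the choice of the argument, see [arg_varE]. *)
Definition arg_var f : K :=
  let T := get [set T : K -> K | continuous T /\
    forall t, 0 <= t <= 1 -> is_arg (T t) (f t)] in T 1 - T 0.

Lemma arg_varE f (T : K -> K) : continuous T ->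
  (forall t, 0 <= t <= 1 -> is_arg (T t) (f t)) -> arg_var f = T 1 - T 0.
Proof.
move=> cT argT; rewrite /arg_var; set P := [set S | _].
have : P (get P) by apply: getPex; exists T.
move: (get P) => S [cS argS].
suff : S 0 - T 0 = S 1 - T 1 by lra.
apply: (@cont_lattice_const K (fun t => S t - T t) (2 * pi)).
- by rewrite mulr_gt0 // pi_gt0.
- by cont.
move=> t tI; have [n ->] := is_arg_unique (argT t tI) (argS t tI).
by exists n; rewrite addrC addKr.
Qed.

Lemma arg_var_ends f a b : continuous f -> (forall t, f t != 0) ->
  is_arg a (f 0) -> is_arg b (f 1) ->
  exists n : int, arg_var f = b - a + n%:~R * (2 * pi).
Proof.
move=> cf f0 af bf; have [T cT argT] := arg_lift cf f0.
rewrite (arg_varE cT argT).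
have [n ->] := is_arg_unique af (argT 0 (ltac:(lra))).
have [m ->] := is_arg_unique bf (argT 1 (ltac:(lra))).
by exists (m - n); rewrite intrB; ring.
Qed.

Lemma arg_var_opp f : continuous f -> (forall t, f t != 0) ->
  arg_var (fun t => - f t) = arg_var f.
Proof.
move=> cf f0; have [T cT argT] := arg_lift cf f0.
rewrite (arg_varE cT argT) (@arg_varE _ (fun t => T t + pi)).
- by lra.
- by cont.
by move=> t tI; apply: is_arg_opp; apply: argT.
Qed.

Lemma arg_var_rot f (w : K -> K) : continuous f -> (forall t, f t != 0) ->
  continuous w ->
  arg_var (fun t => ((f t).1 * cos (w t) - (f t).2 * sin (w t),
                     (f t).1 * sin (w t) + (f t).2 * cos (w t)))
  = arg_var f + (w 1 - w 0).
Proof.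
move=> cf f0 cw; have [T cT argT] := arg_lift cf f0.
rewrite (arg_varE cT argT) (@arg_varE _ (fun t => T t + w t)).
- by lra.
- by cont.
move=> t tI; have /is_argE [r r0 ->] /= := argT t tI.
rewrite -!mulrA -mulrBr -mulrDr; exact: is_arg_rot.
Qed.

(** Both sides vary the argument from the corner [(0, 0)] of the square to the
    opposite one. *)
Lemma arg_var_square (f : K * K -> K * K) :
  continuous f -> (forall x, f x != 0) ->
  arg_var (fun t => f (0, t)) + arg_var (fun s => f (s, 1))
  = arg_var (fun s => f (s, 0)) + arg_var (fun t => f (1, t)).
Proof.
move=> cf f0; have [T cT argT] := arg_lift2 cf f0.
rewrite (@arg_varE (fun t => f (0, t)) (fun t => T (0, t))); first last.
- by move=> t tI; apply: argT => //; lra.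
- by apply: (cont_comp _ cT); cont.
rewrite (@arg_varE (fun t => f (1, t)) (fun t => T (1, t))); first last.
- by move=> t tI; apply: argT => //; lra.
- by apply: (cont_comp _ cT); cont.
rewrite (@arg_varE (fun s => f (s, 0)) (fun s => T (s, 0))); first last.
- by move=> t tI; apply: argT => //; lra.
- by apply: (cont_comp _ cT); cont.
rewrite (@arg_varE (fun s => f (s, 1)) (fun s => T (s, 1))); first last.
- by move=> t tI; apply: argT => //; lra.
- by apply: (cont_comp _ cT); cont.
by lra.
Qed.

End Lifting.

(** * The complete graph on five vertices does not embed in the plane *)

Section PlaneK5.
Variable K : realType.
Variables (v : 'I_5 -> K * K) (c : 'I_5 -> 'I_5 -> K -> K * K).
Hypothesis v_inj : injective v.
Hypothesis c_cont : forall a b : 'I_5, (a < b)%N -> continuous (c a b).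
Hypothesis c0 : forall a b : 'I_5, (a < b)%N -> c a b 0 = v a.
Hypothesis c1 : forall a b : 'I_5, (a < b)%N -> c a b 1 = v b.
Hypothesis c_disj : forall (a b x y : 'I_5) s t, (a < b)%N -> (x < y)%N ->
  a != x -> a != y -> b != x -> b != y -> c a b s <> c x y t.

(** Variation of the direction in which [w] sees a point running along the edge
    from [a] to [b]. *)
Let view w a b : K := arg_var (fun t => c a b t - v w).

Lemma view_square (a b x y : 'I_5) : (a < b)%N -> (x < y)%N ->
  a != x -> a != y -> b != x -> b != y ->
  view a x y + view y a b = view x a b + view b x y.
Proof.
move=> ab xy ax ay bx by_; rewrite /view.
pose f (u : K * K) := c x y u.2 - c a b u.1.
have cab : continuous (fun u : K * K => c a b u.1).
  by apply: (cont_comp _ (c_cont ab)); cont.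
have cxy : continuous (fun u : K * K => c x y u.2).
  by apply: (cont_comp _ (c_cont xy)); cont.
have f0 u : f u != 0.
  by rewrite subr_eq0; apply/eqP => /esym; apply: c_disj.
have cf : continuous f.
  rewrite /f; move=> u; apply: cvgB; [exact: cxy | exact: cab].
have := arg_var_square cf f0; rewrite /f /= !c0 // !c1 // => e.
have o z (w : K -> K * K) : continuous w -> (forall s, w s - z != 0) ->
    arg_var (fun s => z - w s) = arg_var (fun s => w s - z).
  move=> cw wz; rewrite -(@arg_var_opp _ (fun s => w s - z)) //.
    by congr arg_var; apply/funext => s; rewrite opprB.
  by move=> s; apply: cvgB; [exact: cw | exact: cvg_cst].
rewrite !o // in e.
- exact: c_cont.
- by move=> s; rewrite -(c0 xy) subr_eq0; apply/eqP; apply: c_disj.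
- exact: c_cont.
- by move=> s; rewrite -(c1 xy) subr_eq0; apply/eqP; apply: c_disj.
Qed.

Lemma direction_choice : exists T : 'I_5 -> 'I_5 -> K,
  (forall a b, a != b -> is_arg (T a b) (v b - v a)) /\
  (forall a b : 'I_5, (a < b)%N -> T b a = T a b + pi).
Proof.
have /choice [T0 T0P] : forall u : 'I_5 * 'I_5, exists r : K,
    u.1 != u.2 -> is_arg r (v u.2 - v u.1).
  move=> [a b] /=; have [->|ab] := eqVneq a b; first by exists 0.
  have [|r rP] := @is_arg_exists _ (v b - v a); last by exists r.
  by rewrite subr_eq0 (inj_eq v_inj) eq_sym.
exists (fun a b : 'I_5 => if (a < b)%N then T0 (a, b) else T0 (b, a) + pi); split.
  move=> a b ab; case: ltnP => h; first exact: (T0P (a, b)).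
  by rewrite -opprB; apply: is_arg_opp; apply: (T0P (b, a)); rewrite eq_sym.
by move=> a b ab; rewrite ab ltnNge (ltnW ab).
Qed.

Let sg (p q : 'I_5) : int := if (p < q)%N then -1 else 1.

(** The directions from [a] to [b] and from [b] to [a] differ by a half turn, so
    that the relation of [view_square] turns into one between integers. *)
Lemma view_integers : exists N : 'I_5 -> 'I_5 -> 'I_5 -> int,
  forall a b x y : 'I_5, (a < b)%N -> (x < y)%N ->
  a != x -> a != y -> b != x -> b != y ->
  sg a y + sg x a + sg y b + sg b x
  = 2 * (N x a b + N b x y - N a x y - N y a b).
Proof.
have [T [argT Tpi]] := direction_choice.
pose P w a b := [set n : int |
  view w a b = T w b - T w a + n%:~R * (2 * pi)].
exists (fun w a b => xget 0 (P w a b)) => a b x y ab xy ax ay bx by_.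
have Tsg p q : p != q -> T p q = T q p + (sg p q)%:~R * pi.
  move=> pq; rewrite /sg; case: ltnP => h.
    by rewrite (Tpi p q) // mulrNz mulN1r addrK.
  by rewrite (Tpi q p) ?mul1r // ltn_neqAle h andbT eq_sym.
have Nget (w p q : 'I_5) : (p < q)%N -> w != p -> w != q ->
    (forall t, c p q t != v w) ->
    view w p q = T w q - T w p + (xget 0 (P w p q))%:~R * (2 * pi).
  move=> pq wp wq nv; have : exists n, P w p q n.
    apply: arg_var_ends.
    - by move=> s; apply: cvgB; [exact: c_cont | exact: cvg_cst].
    - by move=> t; rewrite subr_eq0.
    - by rewrite c0 //; apply: argT.
    - by rewrite c1 //; apply: argT.
  by move=> /(xgetPex 0).
have nv1 t : c x y t != v a.
  by rewrite -(c0 ab); apply/eqP => /esym; apply: c_disj.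
have nv2 t : c x y t != v b.
  by rewrite -(c1 ab); apply/eqP => /esym; apply: c_disj.
have nv3 t : c a b t != v x by rewrite -(c0 xy); apply/eqP; apply: c_disj.
have nv4 t : c a b t != v y by rewrite -(c1 xy); apply/eqP; apply: c_disj.
have := view_square ab xy ax ay bx by_.
rewrite !Nget // 1?eq_sym // (Tsg a y) // (Tsg x a) 1?eq_sym //.
rewrite (Tsg y b) 1?eq_sym // (Tsg b x) // => e.
have p0 := pi_gt0 K; apply: (@intr_inj K); apply: (mulIf (lt0r_neq0 p0)).
rewrite !(intrM, intrD, intrN, mulr1z).
move: (xget _ _) (xget _ _) (xget _ _) (xget _ _) e => n1 n2 n3 n4 e; lra.
Qed.

(** This is a parity argument: once the fifteen relations are divided by 2 and
    added up, the integers contribute an even number, since each of them occurs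
    in two relations; but a pair of independent edges contributes an odd
    constant exactly when its end points interleave, which happens five times
    (once for every choice of four vertices). *)
Lemma K5_not_in_plane : False.
Proof.
have [N NP] := view_integers.
pose i k (h : (k < 5)%N) : 'I_5 := Ordinal h.
pose o0 := i 0%N isT; pose o1 := i 1%N isT; pose o2 := i 2%N isT.
pose o3 := i 3%N isT; pose o4 := i 4%N isT.
have add (x y z t : int) : z = t -> x = y -> x + z = y + t by move=> -> ->.
have := NP o0 o1 o2 o3 isT isT isT isT isT isT.
move=> /(add _ _ _ _ (NP o0 o1 o2 o4 isT isT isT isT isT isT)).
move=> /(add _ _ _ _ (NP o0 o1 o3 o4 isT isT isT isT isT isT)).
move=> /(add _ _ _ _ (NP o0 o2 o1 o3 isT isT isT isT isT isT)).
move=> /(add _ _ _ _ (NP o0 o2 o1 o4 isT isT isT isT isT isT)).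
move=> /(add _ _ _ _ (NP o0 o2 o3 o4 isT isT isT isT isT isT)).
move=> /(add _ _ _ _ (NP o0 o3 o1 o2 isT isT isT isT isT isT)).
move=> /(add _ _ _ _ (NP o0 o3 o1 o4 isT isT isT isT isT isT)).
move=> /(add _ _ _ _ (NP o0 o3 o2 o4 isT isT isT isT isT isT)).
move=> /(add _ _ _ _ (NP o0 o4 o1 o2 isT isT isT isT isT isT)).
move=> /(add _ _ _ _ (NP o0 o4 o1 o3 isT isT isT isT isT isT)).
move=> /(add _ _ _ _ (NP o0 o4 o2 o3 isT isT isT isT isT isT)).
move=> /(add _ _ _ _ (NP o1 o2 o3 o4 isT isT isT isT isT isT)).
move=> /(add _ _ _ _ (NP o1 o3 o2 o4 isT isT isT isT isT isT)).
move=> /(add _ _ _ _ (NP o1 o4 o2 o3 isT isT isT isT isT isT)).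
rewrite /sg /=; move: o0 o1 o2 o3 o4 {NP add} => o0 o1 o2 o3 o4.
lia.
Qed.
End PlaneK5.

(** * Arcs of an embedded graph *)

Section Arcs.
Variable K : realType.

Lemma clamp_within_cont (X : topologicalType) (f : K -> X) :
  {within `[0, 1], continuous f} -> continuous (fun t => f (clamp t)).
Proof.
move=> /subspace_continuousP cf t.
have ct : `[0, 1]%classic (clamp t) by rewrite /= in_itv /= clamp_itv.
apply: (cvg_comp (@clamp K) f _ (cf _ ct)).
move=> A /= wA.
have : nbhs t (fun s => `[0, 1]%classic (clamp s) -> A (clamp s)).
  exact: (@clamp_cont K t _ wA).
change (nbhs t (fun s => `[0, 1]%classic (clamp s) -> A (clamp s)) ->
  nbhs t (fun s => A (clamp s))).
by apply: filterS => s; apply; rewrite /= in_itv /= clamp_itv.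
Qed.

Variables (G : sgraph) (X : topologicalType) (S : set X).
Variables (v : G -> X) (c : G -> G -> K -> X).
Hypothesis e : embedding S v c.

Lemma arc_avoids x y z t : adj x y -> z != x -> z != y -> 0 <= t <= 1 ->
  c x y t <> v z.
Proof.
move=> xy zx zy /andP[t0 t1].
move: t0; rewrite le_eqVlt => /predU1P[<-|t0].
  by rewrite (emb_arc0 e xy) => /(emb_vertex_inj e) /eqP; rewrite eq_sym (negbTE zx).
move: t1; rewrite le_eqVlt => /predU1P[->|t1].
  by rewrite (emb_arc1 e xy) => /(emb_vertex_inj e) /eqP; rewrite eq_sym (negbTE zy).
by apply: (emb_arc_vertex e xy); rewrite t0 t1.
Qed.

Lemma arcs_disjoint x y x' y' s t : adj x y -> adj x' y' ->
  x != x' -> x != y' -> y != x' -> y != y' ->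
  0 <= s <= 1 -> 0 <= t <= 1 -> c x y s <> c x' y' t.
Proof.
move=> xy xy' n1 n2 n3 n4 sI tI.
have /andP[t0 t1] := tI.
move: t0; rewrite le_eqVlt => /predU1P[<-|t0].
  by rewrite (emb_arc0 e xy'); apply: arc_avoids; rewrite // eq_sym.
move: t1; rewrite le_eqVlt => /predU1P[->|t1].
  by rewrite (emb_arc1 e xy'); apply: arc_avoids; rewrite // eq_sym.
have /andP[s0 s1] := sI.
move: s0; rewrite le_eqVlt => /predU1P[<-|s0].
  by rewrite (emb_arc0 e xy) => /esym; apply: arc_avoids.
move: s1; rewrite le_eqVlt => /predU1P[->|s1].
  by rewrite (emb_arc1 e xy) => /esym; apply: arc_avoids.
move=> eqc; have := emb_arc_arc e xy xy' (s := s) (t := t).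
rewrite s0 s1 t0 t1 => /(_ isT isT eqc) [[h _ _]|[h _ _]].
  by rewrite h eqxx in n1.
by rewrite h eqxx in n3.
Qed.

End Arcs.

(** * The sphere *)

Section Sphere.
Variable K : realType.

Lemma surface0P (x y z : K) :
  surface 0 (x, y, z) <-> x ^+ 2 + y ^+ 2 + z ^+ 2 = 1.
Proof.
rewrite /surface /= big_ord0 muln0 mulr1 add0n subr0 expr1n.
by split=> h; [rewrite h; ring | rewrite -h; ring].
Qed.

(** Stereographic projection from [(a, b, c)], followed by a linear projection
    of the plane orthogonal to that point onto a coordinate plane: [d] is the
    denominator, and the third coordinate and [d] are recovered from the first
    two because the projected point has inner product -1 with [(a, b, c)] and
    squared norm [2 / d]. *)
Lemma stereographic_inj (a b c x y z x' y' z' d d' : K) : c != 0 ->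
  a ^+ 2 + b ^+ 2 + c ^+ 2 = 1 ->
  x ^+ 2 + y ^+ 2 + z ^+ 2 = 1 -> x' ^+ 2 + y' ^+ 2 + z' ^+ 2 = 1 ->
  d = 1 - (a * x + b * y + c * z) -> d' = 1 - (a * x' + b * y' + c * z') ->
  d != 0 -> d' != 0 ->
  (x - a) / d = (x' - a) / d' -> (y - b) / d = (y' - b) / d' ->
  [/\ x = x', y = y' & z = z'].
Proof.
move=> c0 w1 q1 q1' dE dE' d0 d0' eX eY.
have P (p q r e : K) : e != 0 -> p ^+ 2 + q ^+ 2 + r ^+ 2 = 1 ->
    e = 1 - (a * p + b * q + c * r) ->
    a * ((p - a) / e) + b * ((q - b) / e) + c * ((r - c) / e) = -1 /\
    ((p - a) / e) ^+ 2 + ((q - b) / e) ^+ 2 + ((r - c) / e) ^+ 2 = 2 / e.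
  move=> e0 n1 eE; split; apply: (mulIf e0).
    transitivity (a * p + b * q + c * r - (a ^+ 2 + b ^+ 2 + c ^+ 2)).
      by field.
    by rewrite w1 eE; ring.
  apply: (mulIf e0).
  transitivity (p ^+ 2 + q ^+ 2 + r ^+ 2 + (a ^+ 2 + b ^+ 2 + c ^+ 2)
                - 2 * (a * p + b * q + c * r)).
    by field.
  by rewrite n1 w1; transitivity (2 * e); [rewrite eE; ring | field].
have [l1 l2] := P _ _ _ _ d0 q1 dE; have [m1 m2] := P _ _ _ _ d0' q1' dE'.
have eZ : (z - c) / d = (z' - c) / d'.
  by apply: (mulfI c0); rewrite eX eY in l1; lra.
have ed : d = d'.
  have : 2 / d = 2 / d' by rewrite -l2 -m2 eX eY eZ.
  by move=> /(mulfI (lt0r_neq0 (ltr0n _ 2))) /invr_inj.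
have R (p q r : K) : (p - r) / d = (q - r) / d' -> p = q.
  by rewrite -ed => /(mulIf (invr_neq0 d0)) /addIr.
by split; [exact: R eX | exact: R eY | exact: R eZ].
Qed.

Lemma sphere_point_to_plane (w : K * K * K) : surface 0 w ->
  exists F : K * K * K -> K * K,
    (forall f : K -> K * K * K, continuous f ->
       (forall t, surface 0 (f t)) -> (forall t, f t <> w) ->
       continuous (fun t => F (f t))) /\
    (forall p q, surface 0 p -> surface 0 q -> p <> w -> q <> w ->
       F p = F q -> p = q).
Proof.
case: w => [[a b] c] /surface0P w1.
pose D (q : K * K * K) := 1 - (a * q.1.1 + b * q.1.2 + c * q.2).
have D0 q : surface 0 q -> q <> (a, b, c) -> D q != 0.
  case: q => [[x y] z] /surface0P q1 nw; rewrite /D /=; apply/eqP => h; apply: nw.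
  have s : (x - a) ^+ 2 + (y - b) ^+ 2 + (z - c) ^+ 2 = 0.
    transitivity (x ^+ 2 + y ^+ 2 + z ^+ 2 + (a ^+ 2 + b ^+ 2 + c ^+ 2)
      - 2 + 2 * (1 - (a * x + b * y + c * z))); first by ring.
    by rewrite q1 w1 h; ring.
  have /eqP : (x - a) ^+ 2 + (y - b) ^+ 2 + (z - c) ^+ 2 = 0 by [].
  rewrite !paddr_eq0 ?addr_ge0 ?sqr_ge0 // !sqrf_eq0 !subr_eq0.
  by move=> /andP[/andP[/eqP -> /eqP ->] /eqP ->].
have cF (g h : K * K * K -> K) (r s : K) f :
    (forall f' : K -> K * K * K, continuous f' -> continuous (g \o f')) ->
    (forall f' : K -> K * K * K, continuous f' -> continuous (h \o f')) ->
    continuous f -> (forall t, surface 0 (f t)) ->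
    (forall t : K, f t <> (a, b, c)) ->
    continuous (fun t => ((g (f t) - r) / D (f t), (h (f t) - s) / D (f t))).
  move=> cg ch cf Sf nf.
  have cD : continuous (fun t => (D (f t))^-1).
    by apply: cont_inv; [rewrite /D; cont | move=> t; apply: D0].
  by apply: cont_pair; apply: cont_mul => //; apply: cont_sub; cont;
    [exact: cg | exact: ch].
(* The coordinate that is dropped must be one where the centre is nonzero. *)
have [c0|c0] := eqVneq c 0; last first.
  exists (fun q => ((q.1.1 - a) / D q, (q.1.2 - b) / D q)); split.
    by move=> f cf Sf nf; apply: (cF (fun q => q.1.1) (fun q => q.1.2)) => // f' cf';
      rewrite /comp; cont.
  move=> [[x y] z] [[x' y'] z'] Sp Sq np nq [eX eY].
  have dp := D0 _ Sp np; have dq := D0 _ Sq nq.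
  move/surface0P: Sp => p1; move/surface0P: Sq => q1.
  have [] := stereographic_inj c0 w1 p1 q1 (erefl (D (x, y, z)))
    (erefl (D (x', y', z'))) dp dq eX eY.
  by move=> -> -> ->.
have [b0|b0] := eqVneq b 0; last first.
  exists (fun q => ((q.2 - c) / D q, (q.1.1 - a) / D q)); split.
    by move=> f cf Sf nf; apply: (cF (fun q => q.2) (fun q => q.1.1)) => // f' cf';
      rewrite /comp; cont.
  move=> [[x y] z] [[x' y'] z'] Sp Sq np nq [eX eY].
  have dp := D0 _ Sp np; have dq := D0 _ Sq nq.
  move/surface0P: Sp => p1; move/surface0P: Sq => q1.
  have [| | | | | ] := @stereographic_inj c a b z x y z' x' y' (D (x, y, z))
    (D (x', y', z')) b0 _ _ _ _ _ dp dq eX eY.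
  - by rewrite -w1; ring.
  - by rewrite -p1; ring.
  - by rewrite -q1; ring.
  - by rewrite /D /=; ring.
  - by rewrite /D /=; ring.
  by move=> -> -> ->.
have a0 : a != 0.
  apply/eqP => a0; move: w1; rewrite a0 b0 c0 !expr0n /= !addr0 => /eqP.
  by rewrite eq_sym oner_eq0.
exists (fun q => ((q.1.2 - b) / D q, (q.2 - c) / D q)); split.
  by move=> f cf Sf nf; apply: (cF (fun q => q.1.2) (fun q => q.2)) => // f' cf';
      rewrite /comp; cont.
move=> [[x y] z] [[x' y'] z'] Sp Sq np nq [eX eY].
have dp := D0 _ Sp np; have dq := D0 _ Sq nq.
move/surface0P: Sp => p1; move/surface0P: Sq => q1.
have [| | | | | ] := @stereographic_inj b c a y z x y' z' x' (D (x, y, z))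
  (D (x', y', z')) a0 _ _ _ _ _ dp dq eX eY.
- by rewrite -w1; ring.
- by rewrite -p1; ring.
- by rewrite -q1; ring.
- by rewrite /D /=; ring.
- by rewrite /D /=; ring.
by move=> -> -> ->.
Qed.

(** A sixth vertex provides the centre of a stereographic projection. *)
Lemma K5_not_in_sphere (G : sgraph) (k : 'I_5 -> G) (w : G) : injective k ->
  (forall a b, a != b -> adj (k a) (k b)) -> (forall a, k a != w) ->
  ~ embeds_in_surface K G 0.
Proof.
move=> k_inj k_adj kw [v [c e]].
have [F [cF F_inj]] := sphere_point_to_plane (emb_vertex e w).
have Sarc a b t : a != b -> surface 0 (c (k a) (k b) (clamp t)).
  by move=> ab; apply: (emb_arc e); [exact: k_adj | exact: clamp_itv].
have warc a b t : a != b -> c (k a) (k b) (clamp t) <> v w.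
  move=> ab; apply: (arc_avoids e (k_adj _ _ ab)); rewrite 1?eq_sym ?kw //.
  exact: clamp_itv.
have ltn_neq (a b : 'I_5) : (a < b)%N -> a != b.
  by move=> ab; apply: contraTneq ab => ->; rewrite ltnn.
apply: (@K5_not_in_plane _ (fun a => F (v (k a)))
  (fun a b t => F (c (k a) (k b) (clamp t)))).
- move=> a b /F_inj h; apply: k_inj; apply: (emb_vertex_inj e); apply: h.
  + exact: (emb_vertex e).
  + exact: (emb_vertex e).
  + by move=> /(emb_vertex_inj e) /eqP; rewrite (negbTE (kw a)).
  + by move=> /(emb_vertex_inj e) /eqP; rewrite (negbTE (kw b)).
- move=> a b /ltn_neq ab; apply: cF => [|t|t]; [|exact: Sarc|exact: warc].
  by apply: clamp_within_cont; apply: (emb_arc_cont e); apply: k_adj.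
- by move=> a b /ltn_neq ab; rewrite clamp0 (emb_arc0 e (k_adj _ _ ab)).
- by move=> a b /ltn_neq ab; rewrite clamp1 (emb_arc1 e (k_adj _ _ ab)).
move=> a b x y s t /ltn_neq ab /ltn_neq xy ax ay bx by_ /F_inj h.
have := arcs_disjoint e (k_adj _ _ ab) (k_adj _ _ xy) (s := clamp s)
  (t := clamp t).
rewrite !(inj_eq k_inj) => /(_ ax ay bx by_ (clamp_itv _) (clamp_itv _)); apply.
by apply: h; [exact: Sarc | exact: Sarc | exact: warc | exact: warc].
Qed.

End Sphere.

(** * The torus as a quotient of the plane *)

Section Torus.
Variable K : realType.

Let p2 : 0 < 2 * pi :> K. Proof. by rewrite mulr_gt0 // pi_gt0. Qed.

Definition integral_point (w : K * K) : Prop :=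
  exists m n : int, w = (m%:~R, n%:~R).

Lemma surface1P (x y z : K) : surface 1 (x, y, z) <->
  z ^+ 2 = (9 - ((x - 2) ^+ 2 + y ^+ 2)) * ((x - 2) ^+ 2 + y ^+ 2 - 1).
Proof.
rewrite /surface /= big_ord_recl big_ord0 mulr1 /= muln0 add0n muln1.
rewrite (_ : (2 + 1)%:R = 3) //.
by split=> ->; ring.
Qed.

(** The two angular coordinates of the point [(x, y, z)], in turns: around the
    axis of revolution, and around the circle [(r ^+ 2 - 5) ^+ 2 + z ^+ 2 = 16],
    which is the equation of the torus in terms of the distance [r] to that
    axis. *)
Definition torus_coord (w : K * K) (q : K * K * K) : Prop :=
  is_arg (w.1 * (2 * pi)) (q.1.1 - 2, q.1.2) /\
  is_arg (w.2 * (2 * pi)) ((q.1.1 - 2) ^+ 2 + q.1.2 ^+ 2 - 5, q.2).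

Lemma torus_neq0 (q : K * K * K) : surface 1 q ->
  (q.1.1 - 2, q.1.2) != 0 /\ ((q.1.1 - 2) ^+ 2 + q.1.2 ^+ 2 - 5, q.2) != 0.
Proof.
case: q => [[x y] z] /surface1P /=; set r := (x - 2) ^+ 2 + y ^+ 2 => e.
split; apply/eqP => -[h1 h2].
  have r0 : r = 0 by rewrite /r h1 h2 expr0n addr0.
  by have := sqr_ge0 z; rewrite e r0 => h; lra.
have r5 : r = 5 by rewrite -[RHS]add0r -h1 subrK.
by move/eqP: e; rewrite h2 r5 expr0n /= eq_sym mulf_eq0 => /orP[] /eqP h; lra.
Qed.

Lemma torus_coord_exists q : surface 1 q -> exists w, torus_coord w q.
Proof.
move=> /torus_neq0 [/is_arg_exists [a aP] /is_arg_exists [b bP]].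
have pn : 2 * pi != 0 :> K by rewrite gt_eqF.
by exists (a / (2 * pi), b / (2 * pi)); split; rewrite /= divfK.
Qed.

Lemma torus_coord_unique w w' q : torus_coord w q -> torus_coord w' q ->
  integral_point (w' - w).
Proof.
move=> [a1 a2] [b1 b2].
have [m mE] := is_arg_unique a1 b1; have [n nE] := is_arg_unique a2 b2.
exists m, n; case: w w' {a1 a2 b1 b2} mE nE => w1 w2 [w1' w2'] /= mE nE.
by congr (_, _); apply: (mulIf (lt0r_neq0 p2));
  rewrite mulrDl mulNr ?mE ?nE addrAC subrr add0r.
Qed.

Lemma torus_coord_inj w w' q q' : surface 1 q -> surface 1 q' ->
  torus_coord w q -> torus_coord w' q' -> integral_point (w - w') -> q = q'.
Proof.
move=> Sq Sq' [a1 a2] [b1 b2] [m [n mn]].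
have wE : w = (w'.1 + m%:~R, w'.2 + n%:~R).
  by move: mn; case: (w) (w') => [? ?] [? ?] [<- <-] /=; congr pair; ring.
rewrite wE /= in a1 a2.
rewrite [(w'.1 + _) * _]mulrDl in a1; rewrite [(w'.2 + _) * _]mulrDl in a2.
case: q q' Sq Sq' a1 a2 b1 b2 => [[x y] z] [[x' y'] z'] /surface1P e
  /surface1P e' /= a1 a2 b1 b2.
have {a1 a2} [/is_argE [r r0 [xE yE]] /is_argE [s s0 [rE zE]]] := conj a1 a2.
have {b1 b2} [/is_argE [r' r0' [xE' yE']] /is_argE [s' s0' [rE' zE']]] :=
  conj b1 b2.
rewrite !cossinD2piz in xE yE rE zE.
set c := cos _ in xE xE'; set d := sin _ in yE yE'.
set C := cos _ in rE rE'; set D := sin _ in zE zE'.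
have cd : c ^+ 2 + d ^+ 2 = 1 by apply: cos2Dsin2.
have CD : C ^+ 2 + D ^+ 2 = 1 by apply: cos2Dsin2.
have s4 (u h k : K) : 0 < u -> h - 5 = u * C -> k = u * D ->
    k ^+ 2 = (9 - h) * (h - 1) -> u = 4.
  move=> u0 hE kE kh; have : u ^+ 2 = 4 ^+ 2.
    transitivity ((u * C) ^+ 2 + (u * D) ^+ 2).
      by rewrite !exprMn -mulrDr CD mulr1.
    by rewrite -hE -kE kh; ring.
  by move=> /eqP; rewrite eqf_sqr => /orP[] /eqP uE; lra.
have sE := s4 _ _ _ s0 rE zE e; have sE' := s4 _ _ _ s0' rE' zE' e'.
have zz : z = z' by rewrite zE zE' sE sE'.
have rr : r = r'.
  apply/eqP; rewrite -(@eqrXn2 _ 2) // ?ltW //; apply/eqP.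
  have R (u : K) : u ^+ 2 = (u * c) ^+ 2 + (u * d) ^+ 2.
    by rewrite !exprMn -mulrDr cd mulr1.
  rewrite (R r) (R r') -xE -xE' -yE -yE'.
  by apply: (addIr (- 5)); rewrite rE rE' sE sE'.
by rewrite zz yE yE' rr; congr (_, _, _); apply: (addIr (- 2)); rewrite xE xE' rr.
Qed.

Lemma torus_path_lift (f : K -> K * K * K) w :
  (forall t, surface 1 (f t)) -> continuous (fun t => f (clamp t)) ->
  torus_coord w (f 0) ->
  exists h : K -> K * K, [/\ continuous h, h 0 = w &
    forall t, torus_coord (h t) (f (clamp t))].
Proof.
move=> Sf cf [w1 w2].
have [||T1 cT1 T1P] :=
    @arg_lift _ (fun t => ((f (clamp t)).1.1 - 2, (f (clamp t)).1.2)).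
- by cont.
- by move=> t; have [] := torus_neq0 (Sf (clamp t)).
have [||T2 cT2 T2P] := @arg_lift _ (fun t =>
    (((f (clamp t)).1.1 - 2) ^+ 2 + (f (clamp t)).1.2 ^+ 2 - 5,
     (f (clamp t)).2)).
- by cont.
- by move=> t; have [] := torus_neq0 (Sf (clamp t)).
have I0 : 0 <= (0 : K) <= 1 by rewrite lexx ler01.
have A1 := T1P 0 I0; have A2 := T2P 0 I0; rewrite clamp0 in A1 A2.
have [m mE] := is_arg_unique A1 w1; have [n nE] := is_arg_unique A2 w2.
have pn : 2 * pi != 0 :> K by rewrite gt_eqF.
exists (fun t => (T1 (clamp t) / (2 * pi) + m%:~R,
                  T2 (clamp t) / (2 * pi) + n%:~R)).
split.
- have c1 := cont_comp (@clamp_cont K) cT1.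
  have c2 := cont_comp (@clamp_cont K) cT2.
  by cont.
- rewrite clamp0; case: w mE nE {w1 w2} => u1 u2 /= mE nE.
  by congr (_, _); apply: (mulIf pn); rewrite mulrDl divfK // ?mE ?nE.
move=> t; have tI := clamp_itv t; split; rewrite /= mulrDl divfK //;
  apply: is_argD2piz; [have := T1P _ tI | have := T2P _ tI]; by rewrite clampK.
Qed.

End Torus.

(** * A section of a degree one line bundle on the torus *)

Section Theta.
Variable K : realType.
Implicit Types (w : K * K).

(** The piecewise linear bump [max (0, 1 - |u|)], in a form whose continuity is
    immediate. *)
Definition tent (u : K) : K := (`|u - 1| + `|u + 1|) / 2 - `|u|.

(** With [X = x + 1/2] and [Y = 2 pi (y + 1/2)], this interpolates linearly
    between the values [exp (i n Y)] at the integers [X = n]. It plays the part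
    of a theta function: it vanishes only at the integral points and is
    multiplied by [exp (i m Y)] when [(m, n)] is added to [(x, y)]. *)
Definition theta w : K * K :=
  let X := w.1 + 2^-1 in let Y := (w.2 + 2^-1) * (2 * pi) in
  let n := Num.floor X in let t := X - n%:~R in
  ((1 - t) * cos (n%:~R * Y) + t * cos ((n + 1)%:~R * Y),
   (1 - t) * sin (n%:~R * Y) + t * sin ((n + 1)%:~R * Y)).

(** The same interpolation as a sum of bumps, valid on both sides of the integer
    [n], whereas the formula of [theta] changes there. *)
Let theta3 (n : int) w : K * K :=
  let X := w.1 + 2^-1 in let Y := (w.2 + 2^-1) * (2 * pi) in
  let g (k : int) := tent (X - k%:~R) in
  (g (n - 1) * cos ((n - 1)%:~R * Y) + g n * cos (n%:~R * Y)
     + g (n + 1) * cos ((n + 1)%:~R * Y),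
   g (n - 1) * sin ((n - 1)%:~R * Y) + g n * sin (n%:~R * Y)
     + g (n + 1) * sin ((n + 1)%:~R * Y)).

Let thetaE (n : int) w :
  n%:~R - 1 < w.1 + 2^-1 -> w.1 + 2^-1 < n%:~R + 1 -> theta w = theta3 n w.
Proof.
move=> lo hi; rewrite /theta /theta3 /=.
set X := w.1 + _ in lo hi *; set Y := (w.2 + 2^-1) * (2 * pi).
have /andP[fl fu] := floor_itv X.
have [h|h] : Num.floor X = n \/ Num.floor X = n - 1.
  have h1 : (n - 1 < Num.floor X + 1)%R.
    by rewrite -(ltr_int K) intrB mulr1z; apply: lt_trans fu.
  have h2 : (Num.floor X < n + 1)%R.
    by rewrite -(ltr_int K) intrD mulr1z; apply: le_lt_trans hi.
  by lia.
all: rewrite h in fl fu *; rewrite !(intrB, intrD, mulr1z) in fl fu *.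
all: set N : K := n%:~R in fl fu *.
- have -> : tent (X - (N - 1)) = 0.
    by rewrite /tent !ger0_norm; lra.
  have -> : tent (X - N) = 1 - (X - N).
    by rewrite /tent [`|X - N - 1|]ler0_norm ?[`|X - N|]ger0_norm
      ?[`|X - N + 1|]ger0_norm; lra.
  have -> : tent (X - (N + 1)) = X - N.
    rewrite /tent [`|X - (N + 1)|]ler0_norm ?[`|_ - 1|]ler0_norm
      ?[`|_ + 1|]ger0_norm; lra.
  by congr pair; ring.
- have -> : tent (X - (N - 1)) = 1 - (X - (N - 1)).
    by rewrite /tent [`|X - (N - 1) - 1|]ler0_norm ?[`|X - (N - 1)|]ger0_norm
      ?[`|X - (N - 1) + 1|]ger0_norm; lra.
  have -> : tent (X - N) = X - (N - 1).
    rewrite /tent [`|X - N|]ler0_norm ?[`|_ - 1|]ler0_norm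
      ?[`|_ + 1|]ger0_norm; lra.
  have -> : tent (X - (N + 1)) = 0.
    by rewrite /tent !ler0_norm; lra.
  by rewrite subrK; congr pair; ring.
Qed.

Lemma theta_cont : continuous theta.
Proof.
move=> w0; pose n := Num.floor (w0.1 + 2^-1).
have /andP[fl fu] := floor_itv (w0.1 + 2^-1); rewrite intrD mulr1z -/n in fl fu.
have c3 : continuous (theta3 n).
  have ct : continuous tent by rewrite /tent; cont.
  by rewrite /theta3 /=; cont.
have c1 : continuous (fun w : K * K => w.1 + 2^-1) by cont.
have h1 : n%:~R - 1 < w0.1 + 2^-1 by lra.
have l1 := c1 _ _ (lt_nbhsr h1); have l2 := c1 _ _ (lt_nbhsl fu).
have nr : nbhs w0 (fun w => theta3 n w = theta w).
  near=> w; rewrite (@thetaE n w) //; near: w; [exact: l1 | exact: l2].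
have /cvg_trans := @near_eq_cvg _ _ (nbhs w0) (nbhs_filter w0) _ _ nr; apply.
by rewrite (thetaE h1 fu); exact: c3.
Unshelve. all: by end_near.
Qed.

Lemma theta_neq0 w : ~ integral_point w -> theta w != 0.
Proof.
move=> nw; apply/eqP => -[]; rewrite !intrD mulr1z.
set n := Num.floor _; set Y := (w.2 + 2^-1) * (2 * pi).
set t := w.1 + _ - _ => e1 e2.
(* Division by [exp (i n Y)] leaves the equation [1 - t + t exp (i Y) = 0]. *)
have eC : (1 - t) + t * cos Y = 0.
  have sc := cos2Dsin2 (n%:~R * Y).
  have : ((1 - t) * cos (n%:~R * Y) + t * cos ((n%:~R + 1) * Y)) * cos (n%:~R * Y)
    + ((1 - t) * sin (n%:~R * Y) + t * sin ((n%:~R + 1) * Y)) * sin (n%:~R * Y) = 0.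
    by rewrite e1 e2; ring.
  rewrite [(n%:~R + 1) * Y]mulrDl mul1r cosD sinD => <-.
  transitivity (((1 - t) + t * cos Y) * (cos (n%:~R * Y) ^+ 2 + sin (n%:~R * Y) ^+ 2)).
    by rewrite sc mulr1.
  by ring.
have eS : t * sin Y = 0.
  have sc := cos2Dsin2 (n%:~R * Y).
  have : ((1 - t) * sin (n%:~R * Y) + t * sin ((n%:~R + 1) * Y)) * cos (n%:~R * Y)
    - ((1 - t) * cos (n%:~R * Y) + t * cos ((n%:~R + 1) * Y)) * sin (n%:~R * Y) = 0.
    by rewrite e1 e2; ring.
  rewrite [(n%:~R + 1) * Y]mulrDl mul1r cosD sinD => <-.
  transitivity (t * sin Y * (cos (n%:~R * Y) ^+ 2 + sin (n%:~R * Y) ^+ 2)).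
    by rewrite sc mulr1.
  by ring.
have t0 : t != 0.
  by apply/eqP => t0; move: eC; rewrite t0; lra.
have sY : sin Y = 0 by apply: (mulfI t0); rewrite eS mulr0.
have cY : cos Y = - 1.
  have /eqP := cos2Dsin2 Y; rewrite sY expr0n addr0 -(expr1n _ 2) eqf_sqr.
  case/orP => /eqP cE //; move: eC; rewrite cE; lra.
have t2 : t = 2^-1 by move: eC; rewrite cY; lra.
have [||m mE] := @sin0_cos_gt0 _ (Y - pi).
- by rewrite sinB sY sinpi; ring.
- by rewrite cosB cY cospi sinpi; lra.
have p0 := pi_gt0 K; have pn : 2 * pi != 0 :> K by rewrite gt_eqF // mulr_gt0.
have w1 : w.1 = n%:~R by move: t2; rewrite /t; lra.
have w2 : w.2 = m%:~R by apply: (mulIf pn); rewrite -mE /Y; lra.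
by apply: nw; exists n, m; rewrite -w1 -w2 -surjective_pairing.
Qed.

Lemma theta_translate (w : K * K) (m n : int) :
  let b := m%:~R * ((w.2 + 2^-1) * (2 * pi)) in
  theta (w.1 + m%:~R, w.2 + n%:~R) =
    ((theta w).1 * cos b - (theta w).2 * sin b,
     (theta w).1 * sin b + (theta w).2 * cos b).
Proof.
move=> b; rewrite /theta /=.
set Y := (w.2 + 2^-1) * (2 * pi) in b *.
have -> : w.1 + m%:~R + 2^-1 = (w.1 + 2^-1) + m%:~R by lra.
rewrite floorDrz ?intr_int // intrKfloor.
set N := Num.floor (w.1 + 2^-1).
have -> : w.1 + 2^-1 + m%:~R - (N + m)%:~R = w.1 + 2^-1 - N%:~R.
  by rewrite intrD; lra.
set t := w.1 + _ - _.
have P (k : int) : (k + m)%:~R * ((w.2 + n%:~R + 2^-1) * (2 * pi))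
    = k%:~R * Y + b + ((k + m) * n)%:~R * (2 * pi).
  by rewrite /b /Y !(intrD, intrM); ring.
rewrite (_ : N + m + 1 = (N + 1) + m); last by lia.
by rewrite !P !cossinD2piz !cosD !sinD; congr pair; ring.
Qed.

End Theta.

(** * Intersections of closed curves on the torus *)

Section Pairing.
Variable K : realType.
Implicit Types (e f : K -> K * K) (w u : K * K).

Let p2 : 0 < 2 * pi :> K. Proof. by rewrite mulr_gt0 // pi_gt0. Qed.

Definition lattice_disjoint e f : Prop :=
  forall s t, ~ integral_point (e s - f t).

Let viewl w f : K := arg_var (fun t => theta (w - f t)).
Let viewr e u : K := arg_var (fun s => theta (e s - u)).

Let cont_theta (T : topologicalType) (g h : T -> K * K) :
  continuous g -> continuous h -> continuous (fun x => theta (g x - h x)).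
Proof.
move=> cg ch; apply: (cont_comp _ (@theta_cont K)) => x.
by apply: cvgB; [exact: cg | exact: ch].
Qed.

Let theta_square e f : continuous e -> continuous f -> lattice_disjoint e f ->
  viewl (e 0) f + viewr e (f 1) = viewr e (f 0) + viewl (e 1) f.
Proof.
move=> ce cf ef.
apply: (@arg_var_square _ (fun x : K * K => theta (e x.1 - f x.2))).
  apply: cont_theta; [apply: (cont_comp _ ce) | apply: (cont_comp _ cf)];
  by cont.
by move=> x; apply: theta_neq0; exact: ef.
Qed.

Let viewl_translate w f (m n : int) : continuous f ->
  (forall t, ~ integral_point (w - f t)) ->
  viewl (w + (m%:~R, n%:~R)) f
  = viewl w f - m%:~R * (((f 1).2 - (f 0).2) * (2 * pi)).
Proof.
move=> cf wf; rewrite /viewl.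
pose b t := m%:~R * (((w - f t).2 + 2^-1) * (2 * pi)).
have -> : (fun t => theta (w + (m%:~R, n%:~R) - f t)) = (fun t =>
    ((theta (w - f t)).1 * cos (b t) - (theta (w - f t)).2 * sin (b t),
     (theta (w - f t)).1 * sin (b t) + (theta (w - f t)).2 * cos (b t))).
  by apply/funext => t; rewrite -(theta_translate _ _ n) addrAC.
rewrite arg_var_rot.
- by rewrite /b /=; lra.
- by apply: cont_theta; cont.
- by move=> t; apply: theta_neq0.
have cf2 := cont_snd cf.
by rewrite /b /=; cont.
Qed.

Let viewr_translate e u (m n : int) : continuous e ->
  (forall s, ~ integral_point (e s - u)) ->
  viewr e (u + (m%:~R, n%:~R))
  = viewr e u - m%:~R * (((e 1).2 - (e 0).2) * (2 * pi)).
Proof.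
move=> ce eu; rewrite /viewr.
pose b s := (- m)%:~R * (((e s - u).2 + 2^-1) * (2 * pi)).
have -> : (fun s => theta (e s - (u + (m%:~R, n%:~R)))) = (fun s =>
    ((theta (e s - u)).1 * cos (b s) - (theta (e s - u)).2 * sin (b s),
     (theta (e s - u)).1 * sin (b s) + (theta (e s - u)).2 * cos (b s))).
  apply/funext => s; rewrite -(theta_translate _ _ (- n)); congr theta.
  by rewrite opprD addrA !mulrNz.
rewrite arg_var_rot.
- by rewrite /b /= mulrNz; lra.
- by apply: cont_theta; cont.
- by move=> s; apply: theta_neq0.
have ce2 := cont_snd ce.
by rewrite /b /=; cont.
Qed.

(** The paths [e1], [e2] and [e3] backwards form a closed curve of class
    [(m, n)] on the torus, and likewise [f1], [f2], [f3] one of class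
    [(m', n')]. If the curves are disjoint, their intersection number
    [m n' - n m'] vanishes: it measures how [theta] of the difference of two
    points winds along the boundary of the square that parametrizes the
    product of the curves. *)
Lemma triangle_classes_parallel (e1 e2 e3 f1 f2 f3 : K -> K * K)
    (m n m' n' : int) :
  continuous e1 -> continuous e2 -> continuous e3 ->
  continuous f1 -> continuous f2 -> continuous f3 ->
  e1 0 = e3 0 -> e2 0 = e1 1 -> e2 1 = e3 1 + (m%:~R, n%:~R) ->
  f1 0 = f3 0 -> f2 0 = f1 1 -> f2 1 = f3 1 + (m'%:~R, n'%:~R) ->
  (forall e f, e \in [:: e1; e2; e3] -> f \in [:: f1; f2; f3] ->
    lattice_disjoint e f) ->
  m * n' = n * m'.
Proof.
move=> ce1 ce2 ce3 cf1 cf2 cf3 e10 e20 e21 f10 f20 f21 disj.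
have E1 : e1 \in [:: e1; e2; e3] by rewrite !inE eqxx.
have E2 : e2 \in [:: e1; e2; e3] by rewrite !inE eqxx orbT.
have E3 : e3 \in [:: e1; e2; e3] by rewrite !inE eqxx !orbT.
have F1 : f1 \in [:: f1; f2; f3] by rewrite !inE eqxx.
have F2 : f2 \in [:: f1; f2; f3] by rewrite !inE eqxx orbT.
have F3 : f3 \in [:: f1; f2; f3] by rewrite !inE eqxx !orbT.
have tl f : continuous f -> f \in [:: f1; f2; f3] -> viewl (e2 1) f
    = viewl (e3 1) f - m%:~R * (((f 1).2 - (f 0).2) * (2 * pi)).
  move=> cf /(disj _ _ E3) d; rewrite e21; by apply: viewl_translate.
have tr e : continuous e -> e \in [:: e1; e2; e3] -> viewr e (f2 1)
    = viewr e (f3 1) - m'%:~R * (((e 1).2 - (e 0).2) * (2 * pi)).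
  move=> ce /disj /(_ F3) d; rewrite f21; by apply: viewr_translate.
have := theta_square ce1 cf1 (disj _ _ E1 F1).
have := theta_square ce1 cf2 (disj _ _ E1 F2).
have := theta_square ce1 cf3 (disj _ _ E1 F3).
have := theta_square ce2 cf1 (disj _ _ E2 F1).
have := theta_square ce2 cf2 (disj _ _ E2 F2).
have := theta_square ce2 cf3 (disj _ _ E2 F3).
have := theta_square ce3 cf1 (disj _ _ E3 F1).
have := theta_square ce3 cf2 (disj _ _ E3 F2).
have := theta_square ce3 cf3 (disj _ _ E3 F3).
have l1 := tl _ cf1 F1; have l2 := tl _ cf2 F2; have l3 := tl _ cf3 F3.
have r1 := tr _ ce1 E1; have r2 := tr _ ce2 E2; have r3 := tr _ ce3 E3.
rewrite l1 l2 l3 r1 r2 r3 e10 e20 f10 f20 e21 f21 /=.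
move=> s1 s2 s3 s4 s5 s6 s7 s8 s9.
apply: (@intr_inj K); apply: (mulIf (lt0r_neq0 p2)).
rewrite !intrM; lra.
Qed.

End Pairing.

(** * Two disjoint complete graphs on five vertices do not embed in the torus *)

Section CylinderMap.
Variables (K : realType) (m n u w : int).
Hypothesis bezout : u * m + w * n = 1.

(** The quotient of the plane by the translations along the primitive vector
    [(m, n)], a cylinder, realized as the punctured plane by an exponential. *)
Definition cylinder_map (z : K * K) : K * K :=
  let s := u%:~R * z.1 + w%:~R * z.2 in let t := n%:~R * z.1 - m%:~R * z.2 in
  (expR t * cos (s * (2 * pi)), expR t * sin (s * (2 * pi))).

Lemma cylinder_map_cont : continuous cylinder_map.
Proof.
have ce := @continuous_expR K.
by rewrite /cylinder_map /=; cont.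
Qed.

Lemma cylinder_map_translate (z : K * K) (a b : int) : n * a = m * b ->
  cylinder_map (z + (a%:~R, b%:~R)) = cylinder_map z.
Proof.
move=> ab; rewrite /cylinder_map /=.
have -> : n%:~R * (z.1 + a%:~R) - m%:~R * (z.2 + b%:~R)
    = n%:~R * z.1 - m%:~R * z.2.
  have : (n * a)%:~R = (m * b)%:~R :> K by rewrite ab.
  by rewrite !intrM; lra.
have -> : (u%:~R * (z.1 + a%:~R) + w%:~R * (z.2 + b%:~R)) * (2 * pi)
    = (u%:~R * z.1 + w%:~R * z.2) * (2 * pi) + (u * a + w * b)%:~R * (2 * pi).
  by rewrite intrD !intrM; ring.
by rewrite !cossinD2piz.
Qed.

Lemma cylinder_map_inj z z' : cylinder_map z = cylinder_map z' ->
  integral_point (z - z').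
Proof.
rewrite /cylinder_map /=.
set s := u%:~R * z.1 + w%:~R * z.2; set t := n%:~R * z.1 - m%:~R * z.2.
set s' := u%:~R * z'.1 + w%:~R * z'.2; set t' := n%:~R * z'.1 - m%:~R * z'.2.
move=> e.
have p0 := pi_gt0 K; have pn : 2 * pi != 0 :> K by rewrite gt_eqF // mulr_gt0.
have tt : t = t'.
  apply: expR_inj; apply/eqP; rewrite -(@eqrXn2 _ 2) ?expR_ge0 //; apply/eqP.
  have N (r a : K) : r ^+ 2 = (r * cos a) ^+ 2 + (r * sin a) ^+ 2.
    by rewrite !exprMn -mulrDr cos2Dsin2 mulr1.
  by rewrite (N (expR t) (s * (2 * pi))) (N (expR t') (s' * (2 * pi)));
    case: e => -> ->.
have A := is_arg_polar (s * (2 * pi)) (expR_gt0 t).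
have B := is_arg_polar (s' * (2 * pi)) (expR_gt0 t'); rewrite -e in B.
have [k kE] := is_arg_unique B A.
have ss : s - s' = k%:~R by apply: (mulIf pn); rewrite mulrBl kE addrC addKr.
have b : u%:~R * m%:~R + w%:~R * n%:~R = 1 :> K.
  by rewrite -!intrM -intrD bezout.
have E (y : K * K) : y.1 = m%:~R * (u%:~R * y.1 + w%:~R * y.2)
      + w%:~R * (n%:~R * y.1 - m%:~R * y.2) /\
    y.2 = n%:~R * (u%:~R * y.1 + w%:~R * y.2)
      - u%:~R * (n%:~R * y.1 - m%:~R * y.2).
  split.
    by transitivity ((u%:~R * m%:~R + w%:~R * n%:~R) * y.1);
      [rewrite b mul1r | ring].
  by transitivity ((u%:~R * m%:~R + w%:~R * n%:~R) * y.2);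
    [rewrite b mul1r | ring].
exists (m * k), (n * k); rewrite !intrM -ss.
have [z1 z2] := E z; have [z1' z2'] := E z'.
rewrite -/s -/t in z1 z2; rewrite -/s' -/t' in z1' z2'.
by rewrite [LHS]surjective_pairing /= z1 z2 z1' z2' tt; congr pair; ring.
Qed.

End CylinderMap.

Section TorusK5.
Variables (K : realType) (G : sgraph).
Variables (v : G -> K * K * K) (c : G -> G -> K -> K * K * K).
Hypothesis e : embedding (surface 1) v c.

Let ltn_neq (a b : 'I_5) : (a < b)%N -> a != b.
Proof. by move=> ab; apply: contraTneq ab => ->; rewrite ltnn. Qed.

(** Lifts of the arcs of a complete subgraph to the universal cover. The lifts
    of the vertices are the end points of the lifted star of the vertex 0, so
    that [L a b] is the homology class of the triangle on [0], [a] and [b]. *)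
Record lifted_K5 (k : 'I_5 -> G) (V : 'I_5 -> K * K)
    (E : 'I_5 -> 'I_5 -> K -> K * K) (L : 'I_5 -> 'I_5 -> int * int) : Prop := {
  lift_vertex : forall a, torus_coord (V a) (v (k a));
  lift_cont : forall a b : 'I_5, (a < b)%N -> continuous (E a b);
  lift0 : forall a b : 'I_5, (a < b)%N -> E a b 0 = V a;
  lift1 : forall a b : 'I_5, (a < b)%N ->
    E a b 1 = V b + ((L a b).1%:~R, (L a b).2%:~R);
  lift_arc : forall (a b : 'I_5) t, (a < b)%N ->
    torus_coord (E a b t) (c (k a) (k b) (clamp t));
  lift_star : forall b : 'I_5, L ord0 b = 0 }.

Lemma lifted_K5_exists (k : 'I_5 -> G) :
  (forall a b, a != b -> adj (k a) (k b)) -> exists V E L, lifted_K5 k V E L.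
Proof.
move=> k_adj.
have [V0 V0P] := torus_coord_exists (emb_vertex e (k ord0)).
have lift (a b : 'I_5) z : torus_coord z (v (k a)) -> exists h : K -> K * K,
    (a < b)%N -> [/\ continuous h, h 0 = z &
      forall t, torus_coord (h t) (c (k a) (k b) (clamp t))].
  move=> zP; case: (boolP (a < b)%N) => [/ltn_neq/k_adj ab|_]; last first.
    by exists (fun=> 0).
  have [|||h hP] := @torus_path_lift K (fun t => c (k a) (k b) (clamp t)) z.
  - by move=> t; apply: (emb_arc e ab); exact: clamp_itv.
  - under eq_fun do rewrite clampK.
    by apply: clamp_within_cont; exact: (emb_arc_cont e ab).
  - by rewrite clamp0 (emb_arc0 e ab).
  by exists h => _; case: hP => h1 h2 h3; split=> // t; have := h3 t; rewrite clampK.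
have /choice [S SP] : forall b : 'I_5, exists h : K -> K * K,
    (@ord0 4 < b)%N ->
    [/\ continuous h, h 0 = V0 &
      forall t, torus_coord (h t) (c (k ord0) (k b) (clamp t))].
  by move=> b; exact: (lift ord0 b V0 V0P).
pose V (b : 'I_5) := if b == ord0 then V0 else S b 1.
have VP b : torus_coord (V b) (v (k b)).
  rewrite /V; have [->//|b0] := eqVneq b ord0.
  have b0' : (@ord0 4 < b)%N by rewrite lt0n.
  have [_ _ /(_ 1)] := SP b b0'.
  by rewrite clamp1 (emb_arc1 e (k_adj _ _ (ltn_neq b0'))).
have /choice [T TP] : forall ab : 'I_5 * 'I_5, exists h : K -> K * K,
    (ab.1 < ab.2)%N -> [/\ continuous h, h 0 = V ab.1 &
      forall t, torus_coord (h t) (c (k ab.1) (k ab.2) (clamp t))].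
  by move=> [a b]; exact: (lift a b _ (VP a)).
pose E (a b : 'I_5) := if a == ord0 then S b else T (a, b).
have EP (a b : 'I_5) : (a < b)%N -> [/\ continuous (E a b), E a b 0 = V a &
    forall t, torus_coord (E a b t) (c (k a) (k b) (clamp t))].
  rewrite /E; have [->|a0] := eqVneq a ord0; last exact: (TP (a, b)).
  by rewrite /V eqxx; exact: SP.
have /choice [L LP] : forall ab : 'I_5 * 'I_5, exists l : int * int,
    (ab.1 < ab.2)%N -> E ab.1 ab.2 1 - V ab.2 = (l.1%:~R, l.2%:~R).
  move=> [a b] /=; case: (boolP (a < b)%N) => [ab|_]; last by exists 0.
  have [_ _ /(_ 1)] := EP a b ab.
  rewrite clamp1 (emb_arc1 e (k_adj _ _ (ltn_neq ab))) => E1.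
  by have [m [n mn]] := torus_coord_unique (VP b) E1; exists (m, n).
exists V, E, (fun a b : 'I_5 => if a == ord0 then 0 else L (a, b)); split.
- exact: VP.
- by move=> a b /EP[].
- by move=> a b /EP[].
- move=> a b ab; have [a0|a0] := eqVneq a ord0; last first.
    by rewrite -(LP (a, b) ab) addrC subrK.
  rewrite /E a0 eqxx /V ifN; last by rewrite -lt0n; move: ab; rewrite a0.
  by rewrite /= [X in _ + X](_ : _ = 0) ?addr0.
- by move=> a b t /EP[].
- by move=> b; rewrite eqxx.
Qed.

Lemma lift_disjoint (k k' : 'I_5 -> G) V E L V' E' L' (a b x y : 'I_5) :
  (forall i j, i != j -> adj (k i) (k j)) ->
  (forall i j, i != j -> adj (k' i) (k' j)) ->
  lifted_K5 k V E L -> lifted_K5 k' V' E' L' -> (a < b)%N -> (x < y)%N ->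
  k a != k' x -> k a != k' y -> k b != k' x -> k b != k' y ->
  lattice_disjoint (E a b) (E' x y).
Proof.
move=> k_adj k_adj' l l' ab xy ax ay bx by_ s t h.
have adj1 := k_adj _ _ (ltn_neq ab); have adj2 := k_adj' _ _ (ltn_neq xy).
apply: (arcs_disjoint e adj1 adj2 ax ay bx by_ (clamp_itv s) (clamp_itv t)).
apply: (torus_coord_inj _ _ (lift_arc l s ab) (lift_arc l' t xy) h);
  by apply: (emb_arc e) => //; exact: clamp_itv.
Qed.

(** If all classes are multiples of one primitive vector, then the graph lifts
    to a cylinder. *)
Lemma parallel_classes_absurd (k : 'I_5 -> G) V E L (m n u w : int) :
  injective k -> (forall a b, a != b -> adj (k a) (k b)) ->
  lifted_K5 k V E L -> u * m + w * n = 1 ->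
  (forall a b : 'I_5, (a < b)%N -> n * (L a b).1 = m * (L a b).2) -> False.
Proof.
move=> k_inj k_adj l bez par.
pose F := @cylinder_map K m n u w.
have F_inj := @cylinder_map_inj K m n u w bez.
apply: (@K5_not_in_plane _ (F \o V) (fun a b t => F (E a b t))).
- move=> a b /F_inj h; apply: k_inj; apply: (emb_vertex_inj e).
  by apply: (torus_coord_inj _ _ (lift_vertex l a) (lift_vertex l b) h);
    exact: (emb_vertex e).
- move=> a b ab; apply: (cont_comp (lift_cont l ab)); exact: cylinder_map_cont.
- by move=> a b ab; rewrite (lift0 l ab).
- move=> a b ab; rewrite (lift1 l ab) /F cylinder_map_translate //; exact: par.
move=> a b x y s t ab xy ax ay bx by_ /F_inj.
by apply: (lift_disjoint k_adj k_adj l l); rewrite ?(inj_eq k_inj).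
Qed.

(** The classes of the two graphs are pairwise parallel. So either the second
    graph has no nonzero class, or all classes of the first one are multiples
    of a primitive vector in the direction of a class of the second one. *)
Lemma two_K5_not_in_torus (k k' : 'I_5 -> G) : injective k -> injective k' ->
  (forall a b, a != b -> adj (k a) (k b)) ->
  (forall a b, a != b -> adj (k' a) (k' b)) ->
  (forall a b, k a != k' b) -> False.
Proof.
move=> k_inj k_inj' k_adj k_adj' kk'.
have [V [E [L l]]] := lifted_K5_exists k_adj.
have [V' [E' [L' l']]] := lifted_K5_exists k_adj'.
have par (a b x y : 'I_5) : (a < b)%N -> (x < y)%N ->
    (L a b).1 * (L' x y).2 = (L a b).2 * (L' x y).1.
  move=> ab xy.
  have [->|a0] := eqVneq a ord0; first by rewrite (lift_star l) !mul0r.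
  have [->|x0] := eqVneq x ord0; first by rewrite (lift_star l') !mulr0.
  have a0' : (@ord0 4 < a)%N by rewrite lt0n.
  have x0' : (@ord0 4 < x)%N by rewrite lt0n.
  have b0' := ltn_trans a0' ab; have y0' := ltn_trans x0' xy.
  apply: (@triangle_classes_parallel K (E ord0 a) (E a b) (E ord0 b)
    (E' ord0 x) (E' x y) (E' ord0 y)); try exact: (lift_cont l);
    try exact: (lift_cont l').
  - by rewrite !(lift0 l).
  - by rewrite (lift0 l) // (lift1 l) // (lift_star l) addr0.
  - by rewrite !(lift1 l) // (lift_star l) addr0.
  - by rewrite !(lift0 l').
  - by rewrite (lift0 l') // (lift1 l') // (lift_star l') addr0.
  - by rewrite !(lift1 l') // (lift_star l') addr0.
  move=> f g; rewrite !inE => /or3P[] /eqP -> /or3P[] /eqP ->;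
  by apply: (lift_disjoint k_adj k_adj' l l').
have [z|nz] := pselect (forall x y : 'I_5, (x < y)%N -> L' x y = 0).
  apply: (@parallel_classes_absurd k' V' E' L' 1 0 1 0) => //.
  by move=> a b /z ->; rewrite mul0r mulr0.
have [x [y [xy xyn]]] : exists x y : 'I_5, (x < y)%N /\ L' x y != 0.
  apply: contrapT => h; apply: nz => x y xy; apply/eqP; apply: contrapT => xyn.
  by apply: h; exists x, y; split=> //; apply/negP.
move: par => /(_ _ _ x y _ xy); case: (L' x y) xyn => p q /= pq par.
have [u [w uw]] := Bezoutz p q.
pose d := gcdz p q; have d0 : d != 0.
  by apply: contra pq; rewrite /d gcdz_eq0 => /andP[/eqP -> /eqP ->].
have /dvdzP [p' pE] : (d %| p)%Z by exact: dvdz_gcdl.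
have /dvdzP [q' qE] : (d %| q)%Z by exact: dvdz_gcdr.
apply: (@parallel_classes_absurd k V E L p' q' u w) => //.
  by apply: (mulIf d0); rewrite mul1r mulrDl -!mulrA -pE -qE uw.
move=> a b ab; apply: (mulIf d0).
rewrite mulrAC -qE [RHS]mulrAC -pE mulrC (par _ _ ab); exact: mulrC.
Qed.

End TorusK5.

(** * Disjoint unions of cliques *)

Definition clique_union (G : sgraph) (a b : nat) : Prop :=
  exists2 f : 'I_a * 'I_b -> G, bijective f &
    forall u w, adj (f u) (f w) = (u != w) && (u.1 == w.1).

Lemma clique_union_of_equivalence (G : sgraph) (x0 : G) (e : rel G)
    (a b : nat) :
  (0 < b)%N -> equivalence_rel e ->
  (forall x y, adj x y = (x != y) && e x y) ->
  (forall x, #|[set y | e x y]%SET| = b) -> #|G| = (a * b)%N ->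
  clique_union G a b.
Proof.
move=> b0 equiv adjE cls cardG.
have equivT : {in [set: G]%SET & &, equivalence_rel e}.
  by move=> x y z _ _ _; apply: equiv.
pose P := equivalence_partition e [set: G]%SET.
have partP : finset.partition P [set: G]%SET by exact: equivalence_partitionP.
have cardB B : B \in P -> #|B| = b.
  move=> /imsetP [x _ ->]; rewrite -(cls x); congr #|pred_of_set _|.
  by apply/setP => y; rewrite !inE.
have cardP : size (enum P) = a.
  apply/eqP; rewrite -cardE -(eqn_pmul2r b0) -cardG -cardsT.
  by rewrite (card_uniform_partition cardB partP).
have trivP : finset.trivIset P by case/and3P: partP.
pose B (i : 'I_a) := nth finset.set0 (enum P) i.
have BP i : B i \in P by rewrite -mem_enum mem_nth // cardP.
have sizeB i : size (enum (B i)) = b by rewrite -cardE cardB.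
pose f (u : 'I_a * 'I_b) := nth x0 (enum (B u.1)) u.2.
have fB u : f u \in B u.1 by rewrite -mem_enum mem_nth // sizeB.
have pf u : finset.pblock P (f u) = B u.1 by exact: def_pblock.
have Binj : injective B.
  move=> i j /eqP; rewrite nth_uniq ?cardP ?enum_uniq // => /eqP.
  exact: val_inj.
have finj : injective f.
  move=> [i j] [i' j'] eqf; have := pf (i, j); rewrite eqf pf => /= /Binj ii.
  move: eqf; rewrite /f /= ii => /eqP.
  by rewrite nth_uniq ?sizeB ?enum_uniq // => /eqP /val_inj ->.
exists f.
  by apply: inj_card_bij => //; rewrite card_prod !card_ord cardG.
move=> u w; rewrite adjE (inj_eq finj); congr (_ && _).
rewrite -(pblock_equivalence_partition equivT) ?finset.in_setT // -/P pf.
apply/idP/eqP => [h|->]; last exact: fB.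
by apply: Binj; rewrite -(def_pblock trivP (BP u.1) h) pf.
Qed.

(** An eigenvector sums up over each clique to [z + 1] times its value at any
    vertex of the clique. *)
Lemma clique_union_integral (G : sgraph) (a b : nat) :
  clique_union G a b -> integral_graph G.
Proof.
move=> [f fbij adjf] z /eigenvalueP [v vA v0].
pose h (x : G) : algC := v ord0 (enum_rank x).
have hz y : \sum_x h x * (adj x y)%:R = z * h y.
  have := congr1 (fun M : 'rV_ _ => M ord0 (enum_rank y)) vA.
  rewrite !mxE => <-; rewrite (reindex (@enum_val G G)) /=; last first.
    by apply: onW_bij; exact: enum_val_bij.
  by apply: eq_bigr => i _; rewrite /h mxE enum_valK enum_rankK.
pose S i := \sum_(j < b) h (f (i, j)).
have SE i j : S i = (z + 1) * h (f (i, j)).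
  rewrite mulrDl mul1r -hz (reindex f) /=; last exact: onW_bij.
  rewrite (eq_bigr (fun u => if (u.1 == i) && (u.2 != j) then h (f u) else 0)).
    rewrite -big_mkcond /=.
    rewrite (eq_bigr (fun u => h (f (u.1, u.2)))); last by case.
    rewrite -(pair_big (pred1 i) (predC1 j) (fun i' j' => h (f (i', j')))) /=.
    by rewrite big_pred1_eq /S (bigD1 j) //= addrC.
  move=> [i' j'] _; rewrite adjf /= xpair_eqE.
  by case: (i' == i); case: (j' == j); rewrite /= ?mulr1 ?mulr0.
have [/eqP z1|z1] := boolP (z + 1 == 0).
  by rewrite -[z](addrK 1) z1 sub0r rpredN rpred1.
have [i [j hij]] : exists i j, h (f (i, j)) != 0.
  have /rV0Pn [k vk] := v0; have [g _ gK] := fbij.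
  exists (g (enum_val k)).1, (g (enum_val k)).2.
  by rewrite -surjective_pairing gK /h enum_valK.
have hc j' : h (f (i, j')) = h (f (i, j)).
  by apply: (mulfI z1); rewrite -!SE.
have : S i = b%:R * h (f (i, j)).
  by rewrite /S (eq_bigr _ (fun j' _ => hc j')) sumr_const card_ord mulr_natl.
rewrite (SE i j) => /(mulIf hij) zE.
have -> : z = b%:R - 1 by rewrite -zE addrK.
by rewrite rpredB ?rpred1 // rpred_nat.
Qed.

(** * Non-commutative rings of order p ^ 2 *)

Section Ring.
Variables (p : nat) (R : finZmodType) (mul : R -> R -> R).
Hypotheses (hp : prime p) (hmul : ring_mul mul) (hnc : ~ commutative mul).
Hypothesis hcard : #|R| = (p ^ 2)%N.

Lemma additive_subgroup_dvd (A B : {set R}) :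
  zmod_closed A -> zmod_closed B -> A \subset B -> (#|A| %| #|B|)%N.
Proof.
have grp (C : {set R}) : zmod_closed C -> group_set C.
  move=> [C0 CB]; apply/group_setP; split=> // x y Cx Cy.
  have := CB x (- y) Cx; rewrite opprK; apply.
  by rewrite -[- y]add0r CB.
move=> /grp gA /grp gB AB.
exact: (@cardSg R (Group gB) (Group gA) AB).
Qed.

Definition centralizer (x : R) : {set R} := [set y | mul x y == mul y x]%SET.

Lemma centralizer_closed x : zmod_closed (centralizer x).
Proof.
have [_ mDl mDr] := hmul.
have m0r z : mul z 0 = 0 by apply: (addrI (mul z 0)); rewrite -mDr !addr0.
have m0l z : mul 0 z = 0 by apply: (addrI (mul 0 z)); rewrite -mDl !addr0.
have mNr z y : mul z (- y) = - mul z y.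
  by apply/eqP; rewrite -addr_eq0 -mDr addNr m0r.
have mNl z y : mul (- z) y = - mul z y.
  by apply/eqP; rewrite -addr_eq0 -mDl addNr m0l.
split; first by rewrite inE m0r m0l.
by move=> y z; rewrite !inE => /eqP xy /eqP xz; rewrite mDr mDl mNr mNl xy xz.
Qed.

Lemma center_centralizer x : ring_center mul \subset centralizer x.
Proof.
by apply/fintype.subsetP => y; rewrite !inE => /forallP /(_ x); rewrite eq_sym.
Qed.

Lemma center_closed : zmod_closed (ring_center mul).
Proof.
split=> [|y z]; rewrite !inE; first apply/forallP => x.
  by have [] := centralizer_closed x; rewrite inE eq_sym.
move=> /forallP cy /forallP cz; apply/forallP => x.
have [_ /(_ y z)] := centralizer_closed x.
by rewrite !inE ![mul x _ == _]eq_sym => ->.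
Qed.

Lemma setT_closed : zmod_closed [set: R]%SET.
Proof. by split=> [|y z _ _]; rewrite finset.in_setT. Qed.

(** A proper additive subgroup that contains a nonzero element has order [p]. *)
Lemma card_centralizer x : x \notin ring_center mul -> #|centralizer x| = p.
Proof.
move=> xZ; have [C0 _] := centralizer_closed x.
have := additive_subgroup_dvd (centralizer_closed x) setT_closed (finset.subsetT _).
rewrite cardsT hcard => /(dvdn_pfactor _ _ hp) [[|[|[|k]]] //= _ cE].
- have : [set 0; x]%SET \subset centralizer x.
    apply/fintype.subsetP => y; rewrite !inE => /orP[/eqP ->|/eqP -> //].
    by rewrite inE in C0.
  move=> /subset_leq_card; rewrite cE cards2 eq_sym.
  case: eqP => [x0|//]; move: xZ; rewrite x0.
  by have [-> ] := center_closed.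
case/negP: xZ; rewrite inE; apply/forallP => y.
have : centralizer x == [set: R]%SET.
  by rewrite eqEcard finset.subsetT cardsT hcard cE leqnn.
by move=> /eqP /setP /(_ y); rewrite !inE => /eqP ->.
Qed.

Lemma noncentral_exists : exists x, x \notin ring_center mul.
Proof.
apply: contrapT => h; apply: hnc => x y; apply: contrapT => xy; apply: h.
by exists x; rewrite inE; apply/forallP => /(_ y) /eqP.
Qed.

(** The center is a proper subgroup of a centralizer, whose order is prime. *)
Lemma center_trivial : ring_center mul = [set 0]%SET.
Proof.
have [x xZ] := noncentral_exists; have [Z0 _] := center_closed.
have dv := additive_subgroup_dvd center_closed (centralizer_closed x)
  (center_centralizer x).
rewrite card_centralizer // in dv.
apply/esym/eqP; rewrite eqEcard finset.sub1set Z0 cards1 /=.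
move/primeP: hp => [_ /(_ _ dv)] /orP[/eqP -> //|/eqP cZ].
have /eqP CE : ring_center mul == centralizer x.
  by rewrite eqEcard center_centralizer card_centralizer // cZ leqnn.
by case/negP: xZ; rewrite CE inE.
Qed.

(** Two groups of prime order with a common nonzero element are equal. *)
Lemma commute_centralizer x y : x \notin ring_center mul ->
  y \notin ring_center mul -> mul x y = mul y x -> centralizer x = centralizer y.
Proof.
move=> xZ yZ xy.
have half u w : u \notin ring_center mul -> w \notin ring_center mul ->
    mul u w = mul w u -> centralizer u \subset centralizer w.
  move=> uZ wZ uw; pose I := (centralizer u :&: centralizer w)%SET.
  have Icl : zmod_closed I.
    have [u0 uB] := centralizer_closed u; have [w0 wB] := centralizer_closed w.
    split; first by rewrite finset.in_setI u0 w0.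
    move=> a b; rewrite !finset.in_setI => /andP[au aw] /andP[bu bw].
    by rewrite uB ?wB.
  have := additive_subgroup_dvd Icl (centralizer_closed u) (finset.subsetIl _ _).
  rewrite card_centralizer // => dv.
  have wI : [set 0; w]%SET \subset I.
    apply/fintype.subsetP => z; rewrite !inE => /orP[/eqP ->|/eqP ->].
      have [] := centralizer_closed u; have [] := centralizer_closed w.
      by rewrite !inE => -> _ ->.
    by rewrite uw !eqxx.
  have := subset_leq_card wI; rewrite cards2.
  have -> : 0 != w by apply: contraNneq wZ => <-; have [] := center_closed.
  move/primeP: hp => [_ /(_ _ dv)] /orP[/eqP -> //|/eqP cI _].
  have /eqP <- : I == centralizer u.
    by rewrite eqEcard finset.subsetIl card_centralizer // cI leqnn.
  exact: finset.subsetIr.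
by apply/eqP; rewrite finset.eqEsubset !half.
Qed.

Lemma commuting_graph_cliques : clique_union (commuting_graph mul) p.+1 p.-1.
Proof.
have [x xZ] := noncentral_exists.
have p1 : p.-1.+1 = p by rewrite prednK // prime_gt0.
pose e : rel (commuting_graph mul) := fun u w =>
  mul (val u) (val w) == mul (val w) (val u).
apply: (@clique_union_of_equivalence (commuting_graph mul) (exist _ x xZ) e).
- by rewrite -ltnS p1 prime_gt1.
- move=> u w z; split; first exact: eqxx.
  move=> /eqP uw; rewrite /e.
  have := commute_centralizer (valP u) (valP w) uw.
  by move=> /setP /(_ (val z)); rewrite !inE.
- by [].
- move=> u.
  have -> : [set w | e u w]%SET = (val @^-1: (centralizer (val u) :\ 0))%SET.
    apply/setP => w; rewrite !inE; apply/idP/andP => [uw|[] //]; split=> //.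
    apply/eqP => w0; case/negP: (valP w).
    by rewrite /= w0; have [] := center_closed.
  rewrite -(card_imset _ val_inj).
  have -> : (val @: (val @^-1: (centralizer (val u) :\ 0)
      : {set commuting_graph mul}))%SET = (centralizer (val u) :\ 0)%SET.
    apply/setP => z; apply/imsetP/idP => [[w]|zC]; first by rewrite !inE => ? ->.
    have zZ : z \notin ring_center mul.
      have /setP /(_ z) -> := center_trivial; move: zC.
      by rewrite finset.in_setD1 finset.in_set1 => /andP[].
    by exists (exist _ z zZ) => //; rewrite inE.
  have [C0 _] := centralizer_closed (val u).
  have := cardsD1 0 (centralizer (val u)); rewrite C0 card_centralizer ?(valP u) //.
  by move=> ->.
rewrite card_sig; have := cardC (mem (ring_center mul)).
rewrite hcard center_trivial cards1 => /(canRL (addKn 1)) e1.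
transitivity #|predC (mem [set (0 : R)]%SET)|.
  by apply: eq_card => y; rewrite !inE.
by rewrite e1 subn1 -p1 -mulnn /= mulSn mulnS; lia.
Qed.

End Ring.

(** * Straight-line drawings *)

Section Drawing.
Variable K : realType.

(** Plane coordinates of a straight-line drawing of the complete graph on four
    vertices: a triangle and a point inside it. *)
Definition tetraX (j : nat) : K := nth 0 [:: 0; 2; 1; 1] j.
Definition tetraY (j : nat) : K := nth 0 [:: 0; 0; 3; 1] j.

Lemma tetra_itv j : (j < 4)%N -> 0 <= tetraX j <= 2 /\ 0 <= tetraY j <= 3.
Proof. by case: j => [|[|[|[|//]]]] _; rewrite /tetraX /tetraY /=; split; lra. Qed.

Lemma tetra_inj j k : (j < 4)%N -> (k < 4)%N ->
  tetraX j = tetraX k -> tetraY j = tetraY k -> j = k.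
Proof.
case: j => [|[|[|[|//]]]] _; case: k => [|[|[|[|//]]]] _ //;
  rewrite /tetraX /tetraY /= => e1 e2; exfalso; lra.
Qed.

Lemma tetra_edge_vertex j k l (s : K) :
  (j < 4)%N -> (k < 4)%N -> (l < 4)%N -> j <> k -> 0 < s < 1 ->
  tetraX j + s * (tetraX k - tetraX j) = tetraX l ->
  tetraY j + s * (tetraY k - tetraY j) = tetraY l -> False.
Proof.
case: j => [|[|[|[|//]]]] _; case: k => [|[|[|[|//]]]] _; move=> + jk;
  (try by case: jk); case: l => [|[|[|[|//]]]] _;
  rewrite /tetraX /tetraY /= => /andP[s0 s1] e1 e2; clear jk; lra.
Qed.

Lemma tetra_edges j k l m (s t : K) :
  (j < 4)%N -> (k < 4)%N -> (l < 4)%N -> (m < 4)%N -> j <> k -> l <> m ->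
  0 < s < 1 -> 0 < t < 1 ->
  tetraX j + s * (tetraX k - tetraX j) = tetraX l + t * (tetraX m - tetraX l) ->
  tetraY j + s * (tetraY k - tetraY j) = tetraY l + t * (tetraY m - tetraY l) ->
  [/\ l = j, m = k & t = s] \/ [/\ l = k, m = j & t = 1 - s].
Proof.
case: j => [|[|[|[|//]]]] _; case: k => [|[|[|[|//]]]] _; move=> + + jk;
  (try by case: jk); case: l => [|[|[|[|//]]]] _;
  case: m => [|[|[|[|//]]]] _; move=> lm; (try by case: lm);
  rewrite /tetraX /tetraY /= => /andP[s0 s1] /andP[t0 t1] e1 e2;
  clear jk lm;
  first [ left; split; [reflexivity | reflexivity | lra]
        | right; split; [reflexivity | reflexivity | lra]
        | exfalso; lra ].
Qed.

Lemma convex_itv (lo hi p q t : K) : 0 <= t <= 1 ->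
  lo <= p <= hi -> lo <= q <= hi -> lo <= p + t * (q - p) <= hi.
Proof.
move=> /andP[t0 t1] /andP[p0 p1] /andP[q0 q1]; apply/andP; split; nra.
Qed.

(** Up to six cliques on at most four vertices are drawn side by side in the
    unit disc, and the drawing is lifted to the upper half of the sphere. *)
Lemma clique_union_in_sphere (G : sgraph) (a b : nat) : (a <= 6)%N -> (b <= 4)%N ->
  clique_union G a b -> embeds_in_surface K G 0.
Proof.
move=> a6 b4 [f [g fK gK] adjf].
pose ci x : nat := (g x).1; pose ix x : nat := (g x).2.
have ci6 x : (ci x < 6)%N by exact: leq_trans (ltn_ord _) a6.
have ix4 x : (ix x < 4)%N by exact: leq_trans (ltn_ord _) b4.
have gE x y : ci x = ci y -> ix x = ix y -> x = y.
  move=> h1 h2; rewrite -(gK x) -(gK y); congr f.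
  by rewrite [LHS]surjective_pairing [RHS]surjective_pairing;
    congr (_, _); apply: val_inj.
have adjP x y : adj x y -> ci x = ci y /\ ix x <> ix y.
  rewrite -{1}(gK x) -{1}(gK y) adjf => /andP[xy /eqP c]; split.
    by rewrite /ci c.
  move=> h; move/eqP: xy; apply; rewrite [LHS]surjective_pairing c.
  by rewrite [RHS]surjective_pairing; congr (_, _); apply: val_inj.
(* A clique has width 2 and its translates are 3 apart, so that they are
   disjoint; the factor 1/20 puts all six of them into the unit disc. *)
pose X x : K := ((ci x)%:R * 3 + tetraX (ix x)) / 20.
pose Y x : K := tetraY (ix x) / 20.
pose up (z : K * K) := (z, Num.sqrt (1 - z.1 ^+ 2 - z.2 ^+ 2)).
pose seg x y t := (X x + t * (X y - X x), Y x + t * (Y y - Y x)).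
have Xitv x : 0 <= X x <= 17 / 20.
  have [/andP[h0 h1] _] := tetra_itv (ix4 x).
  have c0 : 0 <= (ci x)%:R :> K by rewrite ler0n.
  have c5 : (ci x)%:R <= 5 :> K by rewrite ler_nat -ltnS.
  by rewrite /X; apply/andP; split; lra.
have Yitv x : 0 <= Y x <= 3 / 20.
  have [_ /andP[h0 h1]] := tetra_itv (ix4 x).
  by rewrite /Y; apply/andP; split; lra.
have upS z : 0 <= z.1 <= 17 / 20 -> 0 <= z.2 <= 3 / 20 -> surface 0 (up z).
  case: z => x y /= /andP[x0 x1] /andP[y0 y1]; apply/surface0P => /=.
  rewrite sqr_sqrtr; first by ring.
  by nra.
have seg0 x y : seg x y 0 = (X x, Y x).
  by rewrite /seg !mul0r !addr0.
have seg1 x y : seg x y 1 = (X y, Y y).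
  by rewrite /seg !mul1r !subrKC.
have ciE x y (u w : K) : 0 <= u <= 2 -> 0 <= w <= 2 ->
    (ci x)%:R * 3 + u = (ci y)%:R * 3 + w -> ci x = ci y.
  move=> /andP[u0 u1] /andP[w0 w1] e.
  have [h|h|//] := ltngtP (ci x) (ci y); exfalso.
    have : (ci x)%:R + 1 <= (ci y)%:R :> K by rewrite natr1 ler_nat.
    by lra.
  have : (ci y)%:R + 1 <= (ci x)%:R :> K by rewrite natr1 ler_nat.
  by lra.
have segX x y t : adj x y -> (seg x y t).1 =
    ((ci x)%:R * 3 + (tetraX (ix x) + t * (tetraX (ix y) - tetraX (ix x)))) / 20.
  by move=> /adjP[c _]; rewrite /seg /X c /=; lra.
have segY x y t : (seg x y t).2 =
    (tetraY (ix x) + t * (tetraY (ix y) - tetraY (ix x))) / 20.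
  by rewrite /seg /Y /=; lra.
have seg_itv x y t : 0 < t < 1 ->
    0 <= tetraX (ix x) + t * (tetraX (ix y) - tetraX (ix x)) <= 2.
  move=> /andP[t0 t1]; apply: convex_itv; first by rewrite !ltW.
    by have [] := tetra_itv (ix4 x).
  by have [] := tetra_itv (ix4 y).
have div20 (u w : K) : u / 20 = w / 20 -> u = w by lra.
exists (fun x => up (X x, Y x)), (fun x y t => up (seg x y t)); split.
- by move=> x; apply: upS; [exact: Xitv | exact: Yitv].
- move=> x y [/div20 eX /div20 eY _].
  have [i1 _] := tetra_itv (ix4 x); have [i2 _] := tetra_itv (ix4 y).
  have c := ciE _ _ _ _ i1 i2 eX; apply: gE => //.
  by apply: tetra_inj => //; move: eX; rewrite c => /addrI.
- move=> x y t _ tI; apply: upS; apply: convex_itv => //;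
    by [exact: Xitv | exact: Yitv].
- move=> x y _; apply: continuous_subspaceT.
  have cs : continuous (fun t => seg x y t) by rewrite /seg; cont.
  have c1 : continuous (fun t => (seg x y t).1) by cont.
  have c2 : continuous (fun t => (seg x y t).2) by cont.
  apply: cont_pair => //.
  apply: (cont_comp _ (@sqrt_continuous K)).
  by cont.
- by move=> x y _; rewrite seg0.
- by move=> x y _; rewrite seg1.
- by move=> x y t _ _; congr up; rewrite /seg; congr (_, _); lra.
- move=> x y z t xy tI [eX eY _].
  have [c n] := adjP _ _ xy.
  have {}eX : (seg x y t).1 = X z by exact: eX.
  have {}eY : (seg x y t).2 = Y z by exact: eY.
  rewrite segX // in eX; rewrite segY in eY.
  move: eX eY => /div20 eX /div20 eY.
  have [i2 _] := tetra_itv (ix4 z).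
  have cz := ciE _ _ _ _ (seg_itv x y t tI) i2 eX.
  apply: (tetra_edge_vertex (ix4 x) (ix4 y) (ix4 z) n tI _ eY).
  by move: eX; rewrite cz => /addrI.
move=> x y x' y' s t xy xy' sI tI [eX eY _].
have [c n] := adjP _ _ xy; have [c' n'] := adjP _ _ xy'.
have {}eX : (seg x y s).1 = (seg x' y' t).1 by exact: eX.
have {}eY : (seg x y s).2 = (seg x' y' t).2 by exact: eY.
rewrite !segX // in eX; rewrite !segY in eY.
move: eX eY => /div20 eX /div20 eY.
have cc := ciE _ _ _ _ (seg_itv x y s sI) (seg_itv x' y' t tI) eX.
have := tetra_edges (ix4 x) (ix4 y) (ix4 x') (ix4 y') n n' sI tI _ eY.
case=> [|[h1 h2 h3]|[h1 h2 h3]].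
- by move: eX; rewrite cc => /addrI.
- by left; split=> //; apply: gE => //; rewrite -?c' -?cc.
by right; split=> //; apply: gE => //; rewrite -?c' -?cc.
Qed.

End Drawing.

(** * The genus of a union of cliques *)

Section Genus.
Variables (K : realType) (G : sgraph) (a b : nat).
Hypothesis cliques : clique_union G a b.

Lemma clique_union_K5 (b5 : (5 <= b)%N) : exists k : 'I_a -> 'I_5 -> G,
  [/\ forall i, injective (k i),
      forall i x y, x != y -> adj (k i x) (k i y) &
      forall i j x y, i != j -> k i x != k j y].
Proof.
have [f /bij_inj f_inj adjf] := cliques.
exists (fun i x => f (i, widen_ord b5 x)); split.
- by move=> i x y /f_inj [] /val_inj.
- by move=> i x y xy; rewrite adjf /= eqxx andbT xpair_eqE eqxx.
by move=> i j x y ij; rewrite (inj_eq f_inj) xpair_eqE (negbTE ij).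
Qed.

Lemma clique_union_not_in_sphere : (0 < a)%N -> (5 < b)%N ->
  ~ embeds_in_surface K G 0.
Proof.
move=> a0 b5; have [f /bij_inj f_inj adjf] := cliques.
pose k x := f (Ordinal a0, widen_ord (ltnW b5) x).
apply: (@K5_not_in_sphere K G k (f (Ordinal a0, Ordinal b5))).
- by move=> x y /f_inj [] /val_inj.
- by move=> x y xy; rewrite adjf /= eqxx andbT xpair_eqE eqxx.
move=> x; rewrite (inj_eq f_inj) xpair_eqE eqxx /= -val_eqE /=.
by rewrite ltn_eqF // ltn_ord.
Qed.

Lemma clique_union_not_in_torus : (1 < a)%N -> (4 < b)%N ->
  ~ embeds_in_surface K G 1.
Proof.
move=> a1 b4 [v [c e]]; have [k [k_inj k_adj kk]] := clique_union_K5 b4.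
pose i0 := Ordinal (ltnW a1); pose i1 := Ordinal a1.
apply: (@two_K5_not_in_torus K G v c e (k i0) (k i1)) => //.
- exact: k_adj.
- exact: k_adj.
by move=> x y; apply: kk.
Qed.

End Genus.

Lemma prime_small_or_large (p : nat) : prime p ->
  (p = 2 \/ p = 3 \/ p = 5)%N \/ (6 < p)%N.
Proof. by case: p => [|[|[|[|[|[|[|p]]]]]]] //; auto. Qed.

End CliquesOnSurfaces.

Import CliquesOnSurfaces.

Theorem proposition3p2 (K : realType) (p : nat) (R : finZmodType)
    (mul : R -> R -> R)
    (hp : prime p)
    (hmul : ring_mul mul)
    (hnc : ~ commutative mul)
    (hcard : #|R| = (p ^ 2)%N) :
  (integral_graph (commuting_graph mul) /\
   ~ toroidal K (commuting_graph mul)) /\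
  (planar K (commuting_graph mul) <-> p = 2 \/ p = 3 \/ p = 5).
Proof.
have cl := commuting_graph_cliques hp hmul hnc hcard.
have small : p = 2 \/ p = 3 \/ p = 5 ->
    embeds_in_surface K (commuting_graph mul) 0.
  move=> h; apply: (clique_union_in_sphere K _ _ cl);
  by case: h => [->|[->|->]].
have large : 6 < p -> ~ embeds_in_surface K (commuting_graph mul) 0 /\
    ~ embeds_in_surface K (commuting_graph mul) 1.
  move=> p6; have p5 : 5 < p.-1 by rewrite -ltnS prednK // prime_gt0.
  split; first exact: (clique_union_not_in_sphere cl).
  by apply: (clique_union_not_in_torus cl);
    [rewrite ltnS prime_gt0 | exact: ltnW].
split; first split.
- exact: clique_union_integral cl.
- move=> [torus minimal].
  case: (prime_small_or_large hp) => [/small sphere|/large []//].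
  by have := minimal _ sphere.
split=> [[sphere _]|/small sphere]; last by split.
by case: (prime_small_or_large hp) => // /large [].
Qed.
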